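(* Let $\Omega\subset\mathbb{R}^2$ be a compact convex set with nonempty interior $\Omega^\circ$, and let $n\ge 1$. For a generic $n$-element set $P=\{p_1,\dots,p_n\}\subset\Omega^\circ$ (that is, for all $(p_1,\dots,p_n)\in(\Omega^\circ)^n$ outside a subset of Lebesgue measure zero), the $\Omega$-tropical curve $C(f)$ of the $\Omega$-tropical series $f=G_P\mathbf{0}_\Omega$ has genus exactly $|P|=n$.
   Context: An $\Omega$-tropical series is a function $f:\Omega\to\mathbb{R}$ such that $f\ge 0$ on $\Omega$, $f=0$ on $\partial\Omega$, and there exist coefficients $c_{ij}\in\mathbb{R}\cup\{+\infty\}$, $(i,j)\in\mathbb{Z}^2$, such that for all $(x,y)\in\Omega^\circ$, $f(x,y)=\min\{c_{ij}+ix+jy : (i,j)\in\mathbb{Z}^2\}$. Let $V(\Omega)$ denote the set of all $\Omega$-tropical series. For $f\in V(\Omega)$, the $\Omega$-tropical curve $C(f)$ is the set of points of $\Omega^\circ$ at which $f$ is not smooth (the corner locus). For a finite set $P\subset\Omega^\circ$ and $f\in V(\Omega)$, define $G_Pf(x,y)=\min\{g(x,y) : g\in V(\Omega),\ g\ge f,\ P\subset C(g)\}$ (pointwise). $\mathbf{0}_\Omega$ denotes the identically zero function on $\Omega$ (an $\Omega$-tropical series). The genus of an $\Omega$-tropical curve $C(f)$ is the number of connected components of $\Omega^\circ\setminus C(f)$ whose closure does not intersect $\partial\Omega$. *)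

(* Defs.v *)
From Stdlib Require Import Reals Lra ZArith.
Open Scope R_scope.

Definition pt := (R * R)%type.
Definition region := pt -> Prop.

Definition dist2 (p q : pt) : R :=
  sqrt ((fst p - fst q) ^ 2 + (snd p - snd q) ^ 2).

Definition is_open (U : region) : Prop :=
  forall p, U p -> exists r, 0 < r /\ forall q, dist2 p q < r -> U q.

Definition r2_interior (S : region) : region :=
  fun p => exists r, 0 < r /\ forall q, dist2 p q < r -> S q.

Definition r2_closure (S : region) : region :=
  fun p => forall r, 0 < r -> exists q, S q /\ dist2 p q < r.

Definition r2_boundary (S : region) : region :=
  fun p => r2_closure S p /\ ~ r2_interior S p.

Definition is_closed (S : region) : Prop := forall p, r2_closure S p -> S p.

Definition is_bounded (S : region) : Prop :=
  exists M, forall p, S p -> Rabs (fst p) <= M /\ Rabs (snd p) <= M.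

Definition is_compact (S : region) : Prop := is_closed S /\ is_bounded S.

Definition is_convex (S : region) : Prop :=
  forall p q t, S p -> S q -> 0 <= t <= 1 ->
    S ((1 - t) * fst p + t * fst q, (1 - t) * snd p + t * snd q).

(* Omega-tropical series: f >= 0 on Omega, f = 0 on the r2_boundary, and on the
   r2_interior f is the minimum of c_ij + i x + j y over (i,j) in Z^2, with
   coefficients in R u {+oo} (None = +oo). *)
Definition tropical_series (Om : region) (f : pt -> R) : Prop :=
  (forall p, Om p -> 0 <= f p) /\
  (forall p, r2_boundary Om p -> f p = 0) /\
  exists c : Z -> Z -> option R,
    forall p, r2_interior Om p ->
      (exists i j r, c i j = Some r /\ f p = r + IZR i * fst p + IZR j * snd p) /\
      (forall i j r, c i j = Some r -> f p <= r + IZR i * fst p + IZR j * snd p).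

Definition differentiable_at (f : pt -> R) (p : pt) : Prop :=
  exists a b : R, forall eps, 0 < eps -> exists delta, 0 < delta /\
    forall h1 h2,
      0 < sqrt (h1 ^ 2 + h2 ^ 2) < delta ->
      Rabs (f (fst p + h1, snd p + h2) - f p - a * h1 - b * h2)
        <= eps * sqrt (h1 ^ 2 + h2 ^ 2).

Definition trop_curve (Om : region) (f : pt -> R) : region :=
  fun p => r2_interior Om p /\ ~ differentiable_at f p.

(* G_P f evaluated: h is G_P f on Omega, i.e. for every q in Omega, h q is the
   minimum of g q over g in V(Omega), g >= f on Omega, P contained in C(g).
   Here P = { pts i | i < n }. *)
Definition admissible (Om : region) (n : nat) (pts : nat -> pt) (f g : pt -> R) : Prop :=
  tropical_series Om g /\
  (forall q, Om q -> f q <= g q) /\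
  (forall i, (i < n)%nat -> trop_curve Om g (pts i)).

Definition is_GP (Om : region) (n : nat) (pts : nat -> pt) (f h : pt -> R) : Prop :=
  forall q, Om q ->
    (exists g, admissible Om n pts f g /\ g q = h q) /\
    (forall g, admissible Om n pts f g -> h q <= g q).

Definition zero_fun : pt -> R := fun _ => 0.

Definition connected (S : region) : Prop :=
  ~ exists U V : region, is_open U /\ is_open V /\
      (forall p, S p -> U p \/ V p) /\
      (exists p, S p /\ U p) /\ (exists p, S p /\ V p) /\
      (forall p, S p -> U p -> V p -> False).

Definition is_component (A S : region) : Prop :=
  (exists p, S p) /\ (forall p, S p -> A p) /\ connected S /\
  forall T : region, connected T -> (forall p, S p -> T p) ->
    (forall p, T p -> A p) -> forall p, T p -> S p.

Definition same_set (S T : region) : Prop := forall p, S p <-> T p.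

Definition bounded_face (Om : region) (f : pt -> R) (S : region) : Prop :=
  is_component (fun p => r2_interior Om p /\ ~ trop_curve Om f p) S /\
  ~ (exists p, r2_closure S p /\ r2_boundary Om p).

Definition genus_eq (Om : region) (f : pt -> R) (k : nat) : Prop :=
  exists faces : nat -> region,
    (forall i, (i < k)%nat -> bounded_face Om f (faces i)) /\
    (forall i j, (i < k)%nat -> (j < k)%nat -> same_set (faces i) (faces j) -> i = j) /\
    (forall S, bounded_face Om f S -> exists i, (i < k)%nat /\ same_set S (faces i)).

(* Lebesgue-null subsets of (R^2)^n (only coordinates i < n of a tuple
   pts : nat -> pt matter): for every eps > 0 they are covered by countably
   many closed boxes whose total volume is < eps. *)
Definition in_box (n : nat) (a b : nat -> pt) (pts : nat -> pt) : Prop :=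
  forall i, (i < n)%nat ->
    fst (a i) <= fst (pts i) <= fst (b i) /\ snd (a i) <= snd (pts i) <= snd (b i).

Fixpoint box_volume (n : nat) (a b : nat -> pt) : R :=
  match n with
  | O => 1
  | S m => box_volume m a b *
           ((fst (b m) - fst (a m)) * (snd (b m) - snd (a m)))
  end.

Definition null_set (n : nat) (N : (nat -> pt) -> Prop) : Prop :=
  forall eps, 0 < eps ->
    exists (a b : nat -> nat -> pt),
      (forall k i, fst (a k i) <= fst (b k i) /\ snd (a k i) <= snd (b k i)) /\
      (forall pts, N pts -> exists k, in_box n (a k) (b k) pts) /\
      exists s, s < eps /\ forall m, sum_f_R0 (fun k => box_volume n (a k) (b k)) m <= s.

(* Main.v *)
Require Import Defs.
From Stdlib Require Import Reals Lra Lia Psatz ZArith List Classical ClassicalEpsilon Cantor.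
Import ListNotations.
Open Scope R_scope.

(** On the interior, every series is [min_a (c a + ev a)] over all monomials [a], with [c >= d]
    for the support function [d a = sup (- ev a)]; it is nonsmooth at a point iff two monomials
    attain the minimum there.  Faces are the regions of strict minimality of one monomial, and for
    [f = G_P 0] such a face reaches the boundary iff [c a = d a].

    At most [n] monomials with [c a > d a] attain the minimum: among [n + 1] of them some nonempty
    subfamily meets the set of minimal monomials at no [p_i] in exactly one element, and lowering
    this subfamily slightly contradicts the minimality of [f].  Conversely, if fewer than [n]
    monomials had [c a > d a], the [n] incidence equations [c a + a . p_i = c b + b . p_i] would
    involve fewer than [n] unknowns, and eliminating these puts [P] on one of countably many affine
    hyperplanes.  The same count shows that each such monomial has a face: otherwise its coefficient
    could be raised without changing [f]. *)

(** * Linear algebra and null sets *)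

(** The bound [d] depends on [Om] alone. A monomial with coefficient [d a] therefore enters the
    incidence equations as a known constant, and the exceptional set can be fixed before the points,
    one piece for each of countably many choices of monomials.

    The coefficients of [f] are infima of coefficients over all admissible series, so no limit of
    series is taken. The corner condition survives: if one monomial were minimal at a point by a
    positive gap, an admissible series nearly optimal for that monomial would have another minimal
    monomial there, whose coefficient is at least the infimum, and the gap would be violated.

    The obstacle at the boundary is irrational slope: at a boundary point no nonconstant
    [d b + ev b] need vanish, and only long lattice vectors given by Dirichlet approximation come
    close. Their length is an advantage: long monomials exceed [f] at the points of [P], so their
    coefficients may be lowered to [d b] without destroying a corner.

    The upper count concerns monomials that merely attain the minimum somewhere; that each of them
    has a face follows only from comparing the two counts. *)

Definition lsum {A} (l : list A) (F : A -> R) : R :=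
  fold_right (fun x s => F x + s) 0 l.

Lemma lsum_app {A} (l1 l2 : list A) F : lsum (l1 ++ l2) F = lsum l1 F + lsum l2 F.
Proof. induction l1 as [|x l1 IH]; simpl; [lra | rewrite IH; lra]. Qed.

Lemma lsum_ext {A} (l : list A) F G :
  (forall x, In x l -> F x = G x) -> lsum l F = lsum l G.
Proof.
  induction l as [|x l IH]; intros H; simpl; [reflexivity|].
  rewrite (H x), IH; auto with datatypes.
Qed.

Lemma lsum_lin {A} (l : list A) s F G :
  lsum l (fun x => s * F x + G x) = s * lsum l F + lsum l G.
Proof. induction l as [|x l IH]; simpl; [lra | rewrite IH; lra]. Qed.

Lemma lsum_scal {A} (l : list A) s F : lsum l (fun x => s * F x) = s * lsum l F.
Proof. induction l as [|x l IH]; simpl; [lra | rewrite IH; lra]. Qed.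

Lemma lsum_abs_le {A} (l : list A) F G :
  (forall x, In x l -> Rabs (F x) <= G x) -> Rabs (lsum l F) <= lsum l G.
Proof.
  induction l as [|x l IH]; intros H; simpl.
  - rewrite Rabs_R0; lra.
  - eapply Rle_trans; [apply Rabs_triang|].
    apply Rplus_le_compat; auto with datatypes.
Qed.

Lemma lsum_const {A} (l : list A) v : lsum l (fun _ => v) = INR (length l) * v.
Proof.
  induction l as [|x l IH]; [simpl; lra|].
  cbn [lsum fold_right length]. rewrite S_INR. fold (lsum l (fun _ => v)). rewrite IH. lra.
Qed.

Lemma lsum_nonneg {A} (l : list A) F :
  (forall x, In x l -> 0 <= F x) -> 0 <= lsum l F.
Proof.
  induction l as [|x l IH]; intros H; simpl; [lra|].
  assert (0 <= F x) by auto with datatypes. assert (0 <= lsum l F) by auto with datatypes. lra.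
Qed.

Lemma lsum_map {A B} (h : A -> B) (l : list A) F :
  lsum (map h l) F = lsum l (fun x => F (h x)).
Proof. induction l as [|x l IH]; simpl; [reflexivity | rewrite IH; reflexivity]. Qed.

(** Forms act on functions; the first clause stands in for functional extensionality. *)
Definition linear_form {A} (phi : (A -> R) -> R) : Prop :=
  (forall e e', (forall x, e x = e' x) -> phi e = phi e') /\
  (forall s e e', phi (fun x => s * e x + e' x) = s * phi e + phi e').

Lemma linear_form_0 {A} (phi : (A -> R) -> R) e :
  linear_form phi -> (forall x, e x = 0) -> phi e = 0.
Proof.
  intros [Hext Hlin] He.
  rewrite (Hext e (fun x => -1 * e x + e x)), Hlin; [lra|].
  intros x; rewrite He; lra.
Qed.

(* More forms than points of the common support are linearly dependent: Gaussian elimination,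
   one point of [K] at a time. *)
Lemma dependent_forms {A} (eq_dec : forall x y : A, {x = y} + {x <> y}) (K : list A) :
  forall (I : list nat) (phi : nat -> (A -> R) -> R),
    NoDup I -> (forall i, linear_form (phi i)) -> (length K < length I)%nat ->
    exists lam : nat -> R, (exists i, In i I /\ lam i <> 0) /\
      forall e, (forall x, ~ In x K -> e x = 0) ->
        lsum I (fun i => lam i * phi i e) = 0.
Proof.
  induction K as [|x K IH]; intros I phi HI Hphi Hlen.
  - exists (fun _ => 1). split.
    + destruct I as [|i I]; simpl in Hlen; [lia|]. exists i; split; [left; auto | lra].
    + intros e He. rewrite (lsum_ext _ _ (fun _ => 0)).
      * rewrite lsum_const; lra.
      * intros i _. rewrite (linear_form_0 _ _ (Hphi i)); [lra|]. intros y; apply He; auto.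
  - set (delta := fun y : A => if eq_dec y x then 1 else 0).
    set (off := fun (e : A -> R) y => if eq_dec y x then 0 else e y).
    (* Splits off the value at [x]; the remainder [off e] is supported on [K]. *)
    assert (Hdec : forall i e, phi i e = e x * phi i delta + phi i (off e)).
    { intros i e. destruct (Hphi i) as [Hext Hlin]. rewrite <- Hlin. apply Hext.
      intros y; unfold delta, off; destruct (eq_dec y x); subst; lra. }
    assert (Hoff : forall e, (forall y, ~ In y (x :: K) -> e y = 0) ->
                             forall y, ~ In y K -> off e y = 0).
    { intros e He y Hy; unfold off; destruct (eq_dec y x) as [|Hne]; [reflexivity|].
      apply He; intros [E|E]; [congruence | contradiction]. }
    destruct (classic (exists i0, In i0 I /\ phi i0 delta <> 0)) as [[i0 [Hi0 Hp]]|Hno].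
    + destruct (in_split _ _ Hi0) as [I1 [I2 ->]].
      set (k := fun i => phi i delta / phi i0 delta).
      set (psi := fun i e => phi i e - k i * phi i0 e).
      destruct (IH (I1 ++ I2) psi) as [lam [[i1 [Hi1 Hl1]] Hlam]].
      * eapply NoDup_remove_1; eassumption.
      * intros i. destruct (Hphi i) as [E1 L1], (Hphi i0) as [E2 L2]. split.
        -- intros e e' He. unfold psi. rewrite (E1 e e' He), (E2 e e' He). reflexivity.
        -- intros s e e'. unfold psi. rewrite L1, L2. ring.
      * rewrite length_app in *; simpl in *; lia.
      (* The pivot form [phi i0] was subtracted [k i] times from each other form; the weight [l0] of
         [i0] collects these multiples. *)
      * pose proof (NoDup_remove_2 _ _ _ HI) as Hni.
        set (l0 := - lsum (I1 ++ I2) (fun i => lam i * k i)).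
        exists (fun i => if Nat.eq_dec i i0 then l0 else lam i). split.
        -- exists i1. split.
           ++ apply in_app_iff in Hi1; apply in_app_iff; simpl; tauto.
           ++ destruct (Nat.eq_dec i1 i0); [subst; contradiction | assumption].
        -- intros e He. specialize (Hlam (off e) (Hoff e He)).
           rewrite lsum_app; simpl.
           assert (Hpsi : forall i, psi i (off e) = phi i e - k i * phi i0 e).
           { intros i. unfold psi. rewrite (Hdec i e), (Hdec i0 e). unfold k. field; assumption. }
           destruct (Nat.eq_dec i0 i0) as [_|]; [|congruence].
           rewrite (lsum_ext I1 _ (fun i => lam i * phi i e)).
           2:{ intros i Hi; destruct (Nat.eq_dec i i0); [|reflexivity].
               subst; destruct Hni; apply in_app_iff; auto. }
           rewrite (lsum_ext I2 _ (fun i => lam i * phi i e)).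
           2:{ intros i Hi; destruct (Nat.eq_dec i i0); [|reflexivity].
               subst; destruct Hni; apply in_app_iff; auto. }
           rewrite (lsum_ext _ _ (fun i => (- phi i0 e) * (lam i * k i) + lam i * phi i e)) in Hlam.
           2:{ intros i _; rewrite Hpsi; ring. }
           rewrite lsum_lin, lsum_app in Hlam. unfold l0.
           rewrite lsum_app in *. lra.
    + destruct (IH I phi HI Hphi) as [lam [Hnz Hlam]]; [simpl in Hlen; lia|].
      exists lam; split; [assumption|]. intros e He.
      rewrite <- (Hlam (off e) (Hoff e He)). apply lsum_ext. intros i Hi.
      rewrite (Hdec i e). replace (phi i delta) with 0; [ring|].
      apply NNPP; intros Hne; apply Hno; exists i; auto.
Qed.

(** * Null sets of point tuples *)

Definition box := ((nat -> pt) * (nat -> pt))%type.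

Definition box_ok (B : box) : Prop :=
  forall i, fst (fst B i) <= fst (snd B i) /\ snd (fst B i) <= snd (snd B i).

(** Finite covers are enough for bounded pieces of hyperplanes, and finite lists can simply be
    concatenated in a countable union. *)
Definition finitely_null (n : nat) (S : (nat -> pt) -> Prop) : Prop :=
  forall eps, 0 < eps -> exists L : list box,
    (forall B, In B L -> box_ok B) /\
    (forall pts, S pts -> exists B, In B L /\ in_box n (fst B) (snd B) pts) /\
    lsum L (fun B => box_volume n (fst B) (snd B)) < eps.

Lemma box_volume_nonneg n (B : box) : box_ok B -> 0 <= box_volume n (fst B) (snd B).
Proof.
  intros H; induction n as [|n IH]; simpl; [lra|].
  destruct (H n). repeat apply Rmult_le_pos; lra.
Qed.

Lemma sum_nth_le {A} (d : A) (F : A -> R) (l : list A) m :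
  (forall x, In x l -> 0 <= F x) -> (m < length l)%nat ->
  sum_f_R0 (fun k => F (nth k l d)) m <= lsum l F.
Proof.
  revert m; induction l as [|x l IH]; intros m Hp Hm; simpl in Hm; [lia|].
  destruct m as [|m].
  - simpl. assert (0 <= lsum l F) by (apply lsum_nonneg; auto with datatypes). lra.
  - rewrite decomp_sum by lia. simpl.
    apply Rplus_le_compat_l. apply IH; [auto with datatypes | lia].
Qed.

(** The [k]-th set gets the budget [e k], and these budgets add up to [eps / 2]. The finite covers
    are concatenated into growing lists [Acc k], whose entries form the required sequence of
    boxes. *)
Lemma countable_union_null n (S : nat -> (nat -> pt) -> Prop) :
  (1 <= n)%nat -> (forall k, finitely_null n (S k)) ->
  null_set n (fun pts => exists k, S k pts).
Proof.
  intros Hn HS eps Heps.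
  set (z := (fun _ => (0, 0), fun _ => (0, 0)) : box).
  assert (Hz : box_ok z) by (intros i; simpl; lra).
  assert (Hz0 : box_volume n (fst z) (snd z) = 0).
  { destruct n as [|n]; [lia|]. simpl. ring. }
  set (e := fun k : nat => eps / 2 * (1 / 2) ^ (k + 1)).
  assert (He : forall k, 0 < e k).
  { intros k; unfold e. apply Rmult_lt_0_compat; [lra | apply pow_lt; lra]. }
  (* The box [z], of volume 0 because [n >= 1], makes each list nonempty, so that [Acc k] has more
     than [k] entries and [nth k (Acc k) z] never falls back on its default. *)
  set (L := fun k => z :: proj1_sig (constructive_indefinite_description _ (HS k (e k) (He k)))).
  assert (HL : forall k, (forall B, In B (L k) -> box_ok B) /\
    (forall pts, S k pts -> exists B, In B (L k) /\ in_box n (fst B) (snd B) pts) /\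
    lsum (L k) (fun B => box_volume n (fst B) (snd B)) < e k).
  { intros k; unfold L. destruct (constructive_indefinite_description _ _) as [l [H1 [H2 H3]]]; simpl.
    split; [|split].
    - intros B [<-|HB]; auto.
    - intros pts Hp. destruct (H2 pts Hp) as [B [HB1 HB2]]. exists B; auto.
    - fold (fst z) (snd z).
      change (box_volume n (fst z) (snd z) + lsum l (fun B => box_volume n (fst B) (snd B)) < e k).
      rewrite Hz0; lra. }
  set (Acc := fix Acc k := match k with O => L O | Datatypes.S k' => Acc k' ++ L k end).
  assert (Hlen : forall k, (k < length (Acc k))%nat).
  { induction k as [|k IH]; simpl; [lia|]. rewrite length_app; simpl; lia. }
  assert (Hext : forall k j, exists l, Acc (k + j)%nat = Acc k ++ l).
  { intros k; induction j as [|j [l Hl]].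
    - exists nil. rewrite Nat.add_0_r, app_nil_r; reflexivity.
    - exists (l ++ L (k + Datatypes.S j)%nat). rewrite app_assoc, <- Hl.
      rewrite <- plus_n_Sm. reflexivity. }
  assert (Hnth : forall i k, (i < length (Acc k))%nat -> nth i (Acc i) z = nth i (Acc k) z).
  { intros i k Hi. destruct (Nat.le_ge_cases i k) as [H|H].
    - destruct (Hext i (k - i)%nat) as [l Hl]. replace (i + (k - i))%nat with k in Hl by lia.
      rewrite Hl, app_nth1; auto.
    - destruct (Hext k (i - k)%nat) as [l Hl]. replace (k + (i - k))%nat with i in Hl by lia.
      rewrite Hl, app_nth1; auto. }
  assert (Hok : forall k B, In B (Acc k) -> box_ok B).
  { induction k as [|k IH]; intros B HB; [apply (HL 0%nat); assumption|].
    simpl in HB. apply in_app_iff in HB as [HB|HB]; [auto | apply (HL (Datatypes.S k)); assumption]. }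
  set (bx := fun k => nth k (Acc k) z).
  exists (fun k => fst (bx k)), (fun k => snd (bx k)). split; [|split].
  - intros k i. apply (Hok k). apply nth_In, Hlen.
  - intros pts [k Hk]. destruct (HL k) as [_ [H2 _]]. destruct (H2 pts Hk) as [B [HB HB']].
    assert (HBA : In B (Acc k)).
    { destruct k; [exact HB|]. cbn [Acc]; apply in_app_iff; right; exact HB. }
    destruct (In_nth _ _ z HBA) as [i [Hi Hi']].
    exists i. unfold bx. rewrite (Hnth i k Hi), Hi'. exact HB'.
  - exists (eps / 2). split; [lra|]. intros m.
    set (V := fun B : box => box_volume n (fst B) (snd B)).
    assert (Htot : forall k, lsum (Acc k) V <= eps / 2 * (1 - (1 / 2) ^ (k + 1))).
    { induction k as [|k IH].
      - simpl Acc. destruct (HL 0%nat) as [_ [_ H3]]. fold V in H3. unfold e in H3.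
        replace (eps / 2 * (1 - (1 / 2) ^ (0 + 1))) with (eps / 2 * (1 / 2) ^ (0 + 1)) by (simpl; lra).
        lra.
      - simpl Acc. rewrite lsum_app. destruct (HL (Datatypes.S k)) as [_ [_ H3]]. fold V in H3.
        unfold e in H3. simpl in IH, H3 |- *. lra. }
    rewrite (sum_eq _ (fun k => V (nth k (Acc m) z))).
    2:{ intros i Hi. unfold bx. rewrite (Hnth i m); [reflexivity|]. pose proof (Hlen m); lia. }
    eapply Rle_trans; [apply sum_nth_le; [|apply Hlen]|].
    + intros B HB. apply box_volume_nonneg, (Hok m), HB.
    + eapply Rle_trans; [apply Htot|].
      assert (0 < (1 / 2) ^ (m + 1)) by (apply pow_lt; lra). nra.
Qed.

Lemma null_set_sub n (N N' : (nat -> pt) -> Prop) :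
  (forall pts, N pts -> N' pts) -> null_set n N' -> null_set n N.
Proof.
  intros H HN eps Heps. destruct (HN eps Heps) as [a [b [H1 [H2 H3]]]].
  exists a, b. split; [exact H1|]. split; [|exact H3]. intros pts Hp; auto.
Qed.

Lemma Rabs_le_inv x M : Rabs x <= M -> - M <= x <= M.
Proof. intros H. pose proof (Rle_abs x). pose proof (Rle_abs (- x)). rewrite Rabs_Ropp in *. lra. Qed.

Lemma lsum_single (l : list nat) F j :
  NoDup l -> In j l -> (forall i, i <> j -> F i = 0) -> lsum l F = F j.
Proof.
  intros Hl Hj HF. destruct (in_split _ _ Hj) as [l1 [l2 ->]].
  pose proof (NoDup_remove_2 _ _ _ Hl) as Hn.
  rewrite lsum_app. simpl.
  rewrite (lsum_ext l1 _ (fun _ => 0)), (lsum_ext l2 _ (fun _ => 0)).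
  - rewrite !lsum_const. lra.
  - intros i Hi. apply HF. intros ->. apply Hn, in_app_iff; auto.
  - intros i Hi. apply HF. intros ->. apply Hn, in_app_iff; auto.
Qed.

Definition upd (a : nat -> pt) (k : nat) (v : pt) : nat -> pt :=
  fun i => if Nat.eq_dec i k then v else a i.

Lemma upd_same a k v : upd a k v k = v.
Proof. unfold upd; destruct (Nat.eq_dec k k); congruence. Qed.

Lemma upd_other a k v i : i <> k -> upd a k v i = a i.
Proof. unfold upd; destruct (Nat.eq_dec i k); congruence. Qed.

(* Boxes with corner [a] all of whose sides have length [h], except the first side of the
   [j]-th factor, which has length [tau]. *)
Definition width (j : nat) (tau h : R) (i : nat) : R := if Nat.eq_dec i j then tau else h.

Definition corner (j : nat) (tau h : R) (a : nat -> pt) : nat -> pt :=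
  fun i => (fst (a i) + width j tau h i, snd (a i) + h).

Fixpoint cell_volume (j : nat) (tau h : R) (n : nat) : R :=
  match n with
  | O => 1
  | S m => cell_volume j tau h m * (width j tau h m * h)
  end.

Lemma box_volume_cell j tau h a n :
  box_volume n a (corner j tau h a) = cell_volume j tau h n.
Proof.
  induction n as [|n IH]; [reflexivity|]. cbn [box_volume cell_volume]. rewrite IH.
  unfold corner; cbn [fst snd]. f_equal. ring.
Qed.

Lemma grid_line m h t :
  0 < h -> (1 <= m)%nat -> 0 <= t <= INR m * h ->
  exists i, (i < m)%nat /\ INR i * h <= t <= INR i * h + h.
Proof.
  intros Hh Hm Ht. induction m as [|m IH]; [lia|].
  rewrite S_INR in Ht. destruct (Rle_lt_dec (INR m * h) t) as [H|H].
  - exists m. split; [lia|]. lra.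
  - destruct m as [|m]; [simpl in H; lra|].
    destruct IH as [i [Hi Hi']]; [lia | lra |]. exists i; split; [lia | exact Hi'].
Qed.

Definition in_cube (n : nat) (M : R) (pts : nat -> pt) : Prop :=
  forall i, (i < n)%nat -> Rabs (fst (pts i)) <= M /\ Rabs (snd (pts i)) <= M.

(** The abscissa of factor [j] is not subdivided, since the cell will later be moved along it. Every
    other coordinate contributes [m] cells of length [h], that is [2 * M] in total; the free one
    contributes [tau]. The second volume identity is multiplied by [2 * M] to replace this missing
    side without a division, and the two cases on [j] carry the induction. *)
Lemma grid_cover (j m : nat) (tau h M : R) :
  0 < h -> (1 <= m)%nat -> INR m * h = 2 * M ->
  forall n, exists G : list (nat -> pt),
    (forall pts, in_cube n M pts -> exists a, In a G /\ forall i, (i < n)%nat ->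
       (i <> j -> fst (a i) <= fst (pts i) <= fst (a i) + h) /\
       snd (a i) <= snd (pts i) <= snd (a i) + h) /\
    ((n <= j)%nat -> INR (length G) * cell_volume j tau h n = (2 * M * (2 * M)) ^ n) /\
    ((j < n)%nat -> INR (length G) * cell_volume j tau h n * (2 * M) = tau * (2 * M * (2 * M)) ^ n).
Proof.
  intros Hh Hm HM. induction n as [|n IH].
  - exists [fun _ => (0, 0)]. split; [|split].
    + intros pts _. eexists; split; [left; reflexivity|]. intros i Hi; lia.
    + intros _. simpl; lra.
    + intros H; lia.
  - destruct IH as [G [Hcov [Hv1 Hv2]]].
    set (mx := if Nat.eq_dec n j then 1%nat else m).
    exists (map (fun q => upd (fst q) n (- M + INR (fst (snd q)) * h, - M + INR (snd (snd q)) * h))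
             (list_prod G (list_prod (seq 0 mx) (seq 0 m)))).
    assert (Hline : forall x, Rabs x <= M -> exists i, (i < m)%nat /\
              - M + INR i * h <= x <= - M + INR i * h + h).
    { intros x Hx. apply Rabs_le_inv in Hx.
      destruct (grid_line m h (x + M) Hh Hm) as [i [Hi Hi']]; [rewrite HM; lra|].
      exists i; split; [exact Hi | lra]. }
    split.
    { intros pts Hp.
      destruct (Hcov pts) as [a [Ha Ha']]; [intros i Hi; apply Hp; lia|].
      destruct (Hp n) as [Hx Hy]; [lia|].
      destruct (Hline _ Hy) as [iy [Hiy Hiy']].
      assert (exists ix, (ix < mx)%nat /\ (n <> j ->
                - M + INR ix * h <= fst (pts n) <= - M + INR ix * h + h)) as [ix [Hix Hix']].
      { unfold mx; destruct (Nat.eq_dec n j) as [E|E].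
        - exists 0%nat; split; [lia | intros; contradiction].
        - destruct (Hline _ Hx) as [ix [H1 H2]]. exists ix; auto. }
      eexists. split.
      - apply in_map_iff. exists (a, (ix, iy)). split; [reflexivity|].
        apply in_prod; [exact Ha|]. apply in_prod; apply in_seq; lia.
      - intros i Hi. simpl fst; simpl snd. destruct (Nat.eq_dec i n) as [->|Hin].
        + rewrite upd_same; simpl. auto.
        + rewrite upd_other by exact Hin. apply Ha'; lia. }
    assert (Hlen : INR (length (map (fun q => upd (fst q) n
               (- M + INR (fst (snd q)) * h, - M + INR (snd (snd q)) * h))
             (list_prod G (list_prod (seq 0 mx) (seq 0 m)))))
             = INR (length G) * (INR mx * INR m)).
    { rewrite length_map, !length_prod, !length_seq, !mult_INR. reflexivity. }
    rewrite Hlen. cbn [cell_volume pow]. unfold width, mx.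
    destruct (Nat.eq_dec n j) as [E|E]; split; intros Hnj; try lia.
    + specialize (Hv1 ltac:(lia)).
      transitivity ((INR (length G) * cell_volume j tau h n) * tau * (INR m * h) * (2 * M));
        [simpl (INR 1); ring|]. rewrite Hv1, HM; ring.
    + specialize (Hv1 ltac:(lia)).
      transitivity ((INR (length G) * cell_volume j tau h n) * (INR m * h) * (INR m * h)); [ring|].
      rewrite Hv1, HM; ring.
    + specialize (Hv2 ltac:(lia)).
      transitivity ((INR (length G) * cell_volume j tau h n * (2 * M)) * (INR m * h) * (INR m * h)); [ring|].
      rewrite Hv2, HM; ring.
Qed.

Definition linear_value (n : nat) (u v : nat -> R) (pts : nat -> pt) : R :=
  lsum (seq 0 n) (fun i => u i * fst (pts i) + v i * snd (pts i)).

Lemma linear_value_sub n u v p q :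
  linear_value n u v p - linear_value n u v q =
  lsum (seq 0 n) (fun i => u i * (fst (p i) - fst (q i)) + v i * (snd (p i) - snd (q i))).
Proof.
  unfold linear_value.
  replace (lsum (seq 0 n) (fun i => u i * fst (p i) + v i * snd (p i)) -
           lsum (seq 0 n) (fun i => u i * fst (q i) + v i * snd (q i)))
    with ((-1) * lsum (seq 0 n) (fun i => u i * fst (q i) + v i * snd (q i)) +
          lsum (seq 0 n) (fun i => u i * fst (p i) + v i * snd (p i))) by ring.
  rewrite <- lsum_lin. apply lsum_ext. intros i _. ring.
Qed.

(* A fine grid in all other coordinates leaves for the [j]-th abscissa an interval of length
   proportional to the mesh. *)
Lemma hyperplane_null_fst n j M u v w :
  (j < n)%nat -> u j <> 0 -> 0 < M ->
  finitely_null n (fun pts => in_cube n M pts /\ linear_value n u v pts = w).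
Proof.
  intros Hj Hu HM eps Heps.
  (* Solving the equation for the [j]-th abscissa, a change of all other coordinates by at most [h]
     moves the solution by at most [kap * h]; hence [tau = 2 * kap * h] below. *)
  set (kap := lsum (seq 0 n) (fun i => Rabs (u i) + Rabs (v i)) / Rabs (u j)).
  assert (Huj : 0 < Rabs (u j)) by (apply Rabs_pos_lt; exact Hu).
  assert (Hkap : 0 <= kap).
  { unfold kap. apply Rmult_le_pos; [|left; apply Rinv_0_lt_compat; exact Huj].
    apply lsum_nonneg. intros i _. pose proof (Rabs_pos (u i)); pose proof (Rabs_pos (v i)); lra. }
  (* With mesh [h = 2 * M / m] the total volume is [Q / m], so [m > Q / eps] suffices. *)
  set (Q := 2 * kap * (2 * M * (2 * M)) ^ n).
  destruct (INR_unbounded (Q / eps)) as [m0 Hm0].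
  set (m := S m0). assert (Hm : (1 <= m)%nat) by (unfold m; lia).
  assert (HmR : 0 < INR m) by (apply lt_0_INR; lia).
  assert (HQ : Q < eps * INR m).
  { apply (Rmult_lt_compat_r eps) in Hm0; [|exact Heps].
    unfold Rdiv in Hm0; rewrite Rmult_assoc, Rinv_l in Hm0 by lra.
    unfold m; rewrite S_INR. nra. }
  set (h := 2 * M / INR m).
  assert (Hh : 0 < h) by (unfold h; apply Rdiv_lt_0_compat; lra).
  assert (Hmh : INR m * h = 2 * M) by (unfold h; field; lra).
  set (tau := 2 * kap * h).
  destruct (grid_cover j m tau h M Hh Hm Hmh n) as [G [Hcov [_ Hvol]]].
  specialize (Hvol Hj).
  (* The [j]-th abscissa solving the equation when the other coordinates are those of the corner
     [a]; [low] centres the free side at it. *)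
  set (beta := fun a => (w - linear_value n u v (upd a j (0, snd (a j)))) / u j).
  set (low := fun a => upd a j (beta a - kap * h, snd (a j))).
  exists (map (fun a => (low a, corner j tau h (low a))) G). split; [|split].
  - intros B HB. apply in_map_iff in HB as [a [<- _]]. intros i; simpl.
    unfold width, tau; destruct (Nat.eq_dec i j); nra.
  - intros pts [Hc Hw]. destruct (Hcov pts Hc) as [a [Ha Ha']].
    eexists; split; [apply in_map_iff; exists a; split; [reflexivity | exact Ha]|].
    intros i Hi; simpl. destruct (Ha' i Hi) as [H1 H2]. unfold low, width.
    destruct (Nat.eq_dec i j) as [->|Hij].
    + rewrite upd_same; simpl.
      split; [|lra].
      set (p0 := upd pts j (0, snd (pts j))). set (a0 := upd a j (0, snd (a j))).
      assert (E1 : linear_value n u v pts - linear_value n u v p0 = u j * fst (pts j)).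
      { rewrite linear_value_sub. rewrite (lsum_single _ _ j).
        - unfold p0; rewrite upd_same; simpl; ring.
        - apply seq_NoDup.
        - apply in_seq; lia.
        - intros k Hk. unfold p0; rewrite upd_other by exact Hk. ring. }
      assert (E2 : Rabs (linear_value n u v p0 - linear_value n u v a0) <= kap * Rabs (u j) * h).
      { rewrite linear_value_sub. unfold kap.
        replace (lsum (seq 0 n) (fun i => Rabs (u i) + Rabs (v i)) / Rabs (u j) * Rabs (u j) * h)
          with (h * lsum (seq 0 n) (fun i => Rabs (u i) + Rabs (v i))) by (field; lra).
        rewrite <- lsum_scal. apply lsum_abs_le. intros k Hk. apply in_seq in Hk.
        assert (Rabs (fst (p0 k) - fst (a0 k)) <= h /\ Rabs (snd (p0 k) - snd (a0 k)) <= h) as [B1 B2].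
        { destruct (Ha' k ltac:(lia)) as [C1 C2]. unfold p0, a0.
          destruct (Nat.eq_dec k j) as [->|Hkj].
          - rewrite !upd_same; simpl. split; apply Rabs_le; lra.
          - rewrite !upd_other by exact Hkj. specialize (C1 Hkj). split; apply Rabs_le; lra. }
        eapply Rle_trans; [apply Rabs_triang|]. rewrite !Rabs_mult.
        pose proof (Rabs_pos (u k)); pose proof (Rabs_pos (v k)). nra. }
      assert (E3 : fst (pts j) - beta a = - ((linear_value n u v p0 - linear_value n u v a0) / u j)).
      { unfold beta; fold a0. rewrite <- Hw.
        replace (linear_value n u v pts) with (u j * fst (pts j) + linear_value n u v p0) by lra.
        field; exact Hu. }
      assert (E4 : Rabs (fst (pts j) - beta a) <= kap * h).
      { rewrite E3, Rabs_Ropp. unfold Rdiv. rewrite Rabs_mult, Rabs_inv.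
        apply (Rmult_le_reg_r (Rabs (u j))); [exact Huj|].
        rewrite Rmult_assoc, Rinv_l by lra. lra. }
      apply Rabs_le_inv in E4. unfold tau. lra.
    + rewrite upd_other by exact Hij. split; [exact (H1 Hij) | exact H2].
  - rewrite lsum_map. cbn [fst snd].
    rewrite (lsum_ext _ _ (fun _ => cell_volume j tau h n)) by (intros; apply box_volume_cell).
    rewrite lsum_const.
    apply (Rmult_lt_reg_r (2 * M)); [lra|]. rewrite Hvol.
    apply (Rmult_lt_reg_r (INR m)); [exact HmR|].
    replace (tau * (2 * M * (2 * M)) ^ n * INR m) with (Q * (INR m * h)) by (unfold Q, tau; ring).
    rewrite Hmh. nra.
Qed.

Definition swap (p : pt) : pt := (snd p, fst p).

(** Exchanging the two coordinates of every point preserves volumes; this reduces a nonzero ordinate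
    coefficient to a nonzero abscissa coefficient. *)
Lemma finitely_null_swap n (N N' : (nat -> pt) -> Prop) :
  (forall pts, N' pts -> N (fun i => swap (pts i))) -> finitely_null n N -> finitely_null n N'.
Proof.
  intros H HN eps Heps. destruct (HN eps Heps) as [L [H1 [H2 H3]]].
  exists (map (fun B => (fun i => swap (fst B i), fun i => swap (snd B i))) L). split; [|split].
  - intros B HB. apply in_map_iff in HB as [C [<- HC]]. intros i; simpl.
    destruct (H1 C HC i); auto.
  - intros pts Hp. destruct (H2 _ (H _ Hp)) as [B [HB HB']].
    eexists; split; [apply in_map_iff; exists B; split; [reflexivity | exact HB]|].
    intros i Hi; simpl. destruct (HB' i Hi) as [X Y]; simpl in X, Y. auto.
  - rewrite lsum_map. cbn [fst snd]. erewrite lsum_ext; [exact H3|]. intros B _. simpl.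
    induction n as [|n IH] in |- *; [reflexivity|]. simpl. rewrite IH. ring.
Qed.

Lemma hyperplane_null n j M u v w :
  (j < n)%nat -> u j <> 0 \/ v j <> 0 -> 0 < M ->
  finitely_null n (fun pts => in_cube n M pts /\ linear_value n u v pts = w).
Proof.
  intros Hj [Hu|Hv] HM; [apply (hyperplane_null_fst n j); assumption|].
  eapply finitely_null_swap; [|apply (hyperplane_null_fst n j M v u w Hj Hv HM)].
  intros pts [Hc Hw]. split.
  - intros i Hi; simpl. destruct (Hc i Hi); auto.
  - rewrite <- Hw. apply lsum_ext. intros i _. simpl. ring.
Qed.

(** * Exceptional configurations *)

Definition mono := (Z * Z)%type.

Definition ev (a : mono) (p : pt) : R := IZR (fst a) * fst p + IZR (snd a) * snd p.

Lemma mono_eq_dec (a b : mono) : {a = b} + {a <> b}.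
Proof. decide equality; apply Z.eq_dec. Qed.

(* Eliminating the fewer than [n] coefficients on [K] leaves a linear condition on [pts]. *)
Definition special (d : mono -> R) (n : nat) (pts : nat -> pt) : Prop :=
  exists (c : mono -> R) (K : list mono), (length K < n)%nat /\
    forall i, (i < n)%nat -> exists a b, a <> b /\
      c a + ev a (pts i) = c b + ev b (pts i) /\
      (c a <> d a -> In a K) /\ (c b <> d b -> In b K).

(** The discrete data of [special]: [s i] holds the two monomials of the [i]-th equation and, as
    last entry, the [i]-th element of [K]. Only [n - 1] last entries are read, as [K] has fewer than
    [n] elements. *)
Definition special_pattern (d : mono -> R) (n : nat) (s : nat -> mono * mono * mono)
  (pts : nat -> pt) : Prop :=
  exists c : mono -> R,
    (forall x, ~ In x (map (fun i => snd (s i)) (seq 0 (n - 1))) -> c x - d x = 0) /\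
    forall i, (i < n)%nat -> fst (fst (s i)) <> snd (fst (s i)) /\
      c (fst (fst (s i))) + ev (fst (fst (s i))) (pts i) =
      c (snd (fst (s i))) + ev (snd (fst (s i))) (pts i).

(** On [c - d], supported on [n - 1] monomials, the [n] forms given by the pairs are dependent. The
    dependency [lam] removes the unknown coefficients from the equations and leaves a linear
    equation for the points, nontrivial where [lam j <> 0] because [a j] and [b j] differ. *)
Lemma special_pattern_null d n s M :
  (1 <= n)%nat -> 0 < M ->
  finitely_null n (fun pts => in_cube n M pts /\ special_pattern d n s pts).
Proof.
  intros Hn HM.
  set (a := fun i => fst (fst (s i))). set (b := fun i => snd (fst (s i))).
  set (K := map (fun i => snd (s i)) (seq 0 (n - 1))).
  destruct (dependent_forms mono_eq_dec K (seq 0 n) (fun i e => e (a i) - e (b i)))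
    as [lam [[j [Hj Hlj]] Hlam]].
  - apply seq_NoDup.
  - intros i. split; [intros e e' He; rewrite !He; reflexivity | intros; ring].
  - unfold K. rewrite length_map, !length_seq. lia.
  - apply in_seq in Hj.
    (* A pattern with equal monomials is met by no tuple, and the empty cover serves. *)
    destruct (classic (a j = b j)) as [Eab|Eab].
    { intros eps Heps. exists nil. split; [intros B []|]. split; [|simpl; lra].
      intros pts [_ [c [_ Hc]]]. destruct (proj1 (Hc j ltac:(lia))). exact Eab. }
    set (u := fun i => lam i * (IZR (fst (a i)) - IZR (fst (b i)))).
    set (v := fun i => lam i * (IZR (snd (a i)) - IZR (snd (b i)))).
    set (w := lsum (seq 0 n) (fun i => lam i * (d (b i) - d (a i)))).
    assert (Huv : u j <> 0 \/ v j <> 0).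
    { unfold u, v. destruct (Z.eq_dec (fst (a j)) (fst (b j))) as [E1|E1].
      - right. apply Rmult_integral_contrapositive; split; [exact Hlj|].
        intros E2. apply Eab. apply Rminus_diag_uniq in E2. apply eq_IZR in E2.
        destruct (a j), (b j); simpl in *; congruence.
      - left. apply Rmult_integral_contrapositive; split; [exact Hlj|].
        intros E2. apply E1. apply Rminus_diag_uniq in E2. apply eq_IZR in E2. exact E2. }
    intros eps Heps.
    destruct (hyperplane_null n j M u v w ltac:(lia) Huv HM eps Heps) as [L [H1 [H2 H3]]].
    exists L. split; [exact H1|]. split; [|exact H3].
    intros pts [Hc [c [Hsupp Heq]]]. apply H2. split; [exact Hc|].
    specialize (Hlam (fun x => c x - d x) Hsupp).
    (* The added sum is the negative of the combination that vanishes at [c - d]. *)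
    replace w with (w + lsum (seq 0 n)
        (fun i => lam i * ((c (b i) - d (b i)) - (c (a i) - d (a i))))).
    + unfold w, linear_value.
      assert (E0 : forall A (l : list A) F G, lsum l F + lsum l G = lsum l (fun x => F x + G x)).
      { intros A l F G. rewrite <- (Rmult_1_l (lsum l F)), <- lsum_lin.
        apply lsum_ext; intros; ring. }
      rewrite E0. apply lsum_ext. intros i Hi. apply in_seq in Hi.
      destruct (Heq i ltac:(lia)) as [_ E]. fold (a i) (b i) in E. unfold u, v.
      unfold ev in E.
      assert (E' : (IZR (fst (a i)) - IZR (fst (b i))) * fst (pts i) +
              (IZR (snd (a i)) - IZR (snd (b i))) * snd (pts i) = c (b i) - c (a i)) by lra.
      transitivity (lam i * ((IZR (fst (a i)) - IZR (fst (b i))) * fst (pts i) +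
              (IZR (snd (a i)) - IZR (snd (b i))) * snd (pts i))); [ring|].
      rewrite E'. ring.
    + rewrite (lsum_ext _ _ (fun i => (-1) * (lam i * (c (a i) - d (a i) - (c (b i) - d (b i)))))).
      * rewrite lsum_scal, Hlam. ring.
      * intros; ring.
Qed.

Lemma enum_Z : exists e : nat -> Z, forall z, exists k, e k = z.
Proof.
  exists (fun k => (Z.of_nat (fst (of_nat k)) - Z.of_nat (snd (of_nat k)))%Z).
  intros z. exists (to_nat (Z.to_nat z, Z.to_nat (- z))).
  rewrite cancel_of_to. simpl. lia.
Qed.

Lemma enum_pair {A B} :
  (exists e : nat -> A, forall x, exists k, e k = x) ->
  (exists e : nat -> B, forall x, exists k, e k = x) ->
  exists e : nat -> A * B, forall x, exists k, e k = x.
Proof.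
  intros [e He] [f Hf]. exists (fun k => (e (fst (of_nat k)), f (snd (of_nat k)))).
  intros [x y]. destruct (He x) as [i <-], (Hf y) as [j <-].
  exists (to_nat (i, j)). rewrite cancel_of_to. reflexivity.
Qed.

(** Agreement below [n] is all that is asked, which keeps the sequences countable. *)
Lemma enum_seq {A} (e : nat -> A) (n : nat) :
  (forall x, exists k, e k = x) ->
  exists E : nat -> nat -> A, forall s : nat -> A, exists k, forall i, (i < n)%nat -> E k i = s i.
Proof.
  intros He. induction n as [|n [E HE]].
  - exists (fun _ _ => e 0%nat). intros s; exists 0%nat; intros; lia.
  - exists (fun k i => if Nat.eq_dec i n then e (snd (of_nat k)) else E (fst (of_nat k)) i).
    intros s. destruct (HE s) as [k Hk], (He (s n)) as [l Hl].
    exists (to_nat (k, l)). intros i Hi. rewrite cancel_of_to; simpl.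
    destruct (Nat.eq_dec i n) as [->|]; [exact Hl | apply Hk; lia].
Qed.

Lemma special_null d n M :
  (1 <= n)%nat -> 0 < M -> null_set n (fun pts => in_cube n M pts /\ special d n pts).
Proof.
  intros Hn HM.
  assert (exists e : nat -> mono * mono * mono, forall x, exists k, e k = x) as [e He].
  { pose proof (enum_pair enum_Z enum_Z) as H. apply enum_pair; [apply enum_pair|]; exact H. }
  destruct (enum_seq e n He) as [E HE].
  eapply null_set_sub; [|apply (countable_union_null n
    (fun k pts => in_cube n M pts /\ special_pattern d n (E k) pts) Hn)].
  2:{ intros k. apply special_pattern_null; assumption. }
  intros pts [Hcube [c [K [HK Hab]]]].
  assert (exists ab : nat -> mono * mono, forall i, (i < n)%nat ->
    fst (ab i) <> snd (ab i) /\
    c (fst (ab i)) + ev (fst (ab i)) (pts i) = c (snd (ab i)) + ev (snd (ab i)) (pts i) /\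
    (c (fst (ab i)) <> d (fst (ab i)) -> In (fst (ab i)) K) /\
    (c (snd (ab i)) <> d (snd (ab i)) -> In (snd (ab i)) K)) as [ab Hab'].
  { exists (fun i => epsilon (inhabits ((0, 0), (0, 0))%Z) (fun q : mono * mono =>
      fst q <> snd q /\ c (fst q) + ev (fst q) (pts i) = c (snd q) + ev (snd q) (pts i) /\
      (c (fst q) <> d (fst q) -> In (fst q) K) /\ (c (snd q) <> d (snd q) -> In (snd q) K))).
    intros i Hi. apply epsilon_spec. destruct (Hab i Hi) as [a [b Hq]]. exists (a, b); exact Hq. }
  (* A short [K] is padded with the default [(0, 0)]; an additional allowed monomial does no
     harm. *)
  destruct (HE (fun i => (ab i, nth i K (0, 0)%Z))) as [k Hk].
  exists k. split; [exact Hcube|].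
  (* Resetting [c] to [d] off [K] gives the support condition. The equations keep their terms, since
     a monomial off [K] that occurs in one of them has [c = d] already. *)
  set (cc := fun x => if excluded_middle_informative (In x K) then c x else d x).
  assert (Hcc : forall x, (c x <> d x -> In x K) -> cc x = c x).
  { intros x Hx; unfold cc. destruct (excluded_middle_informative _) as [|Hno]; [reflexivity|].
    destruct (classic (c x = d x)) as [E0|E0]; [auto | destruct Hno; auto]. }
  exists cc. split.
  - intros x Hx. unfold cc. destruct (excluded_middle_informative _) as [HxK|]; [|ring].
    destruct Hx. destruct (In_nth _ _ (0, 0)%Z HxK) as [i [Hi Hi']].
    apply in_map_iff. exists i. split; [|apply in_seq; unfold mono in *; lia].
    rewrite Hk by (unfold mono in *; lia). exact Hi'.
  - intros i Hi. rewrite (Hk i Hi). cbn [fst snd].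
    destruct (Hab' i Hi) as [Q1 [Q2 [Q3 Q4]]]. split; [exact Q1|].
    rewrite (Hcc _ Q3), (Hcc _ Q4). exact Q2.
Qed.

(** * Planar convex geometry *)

(** Squares define the same topology as discs, and estimates of affine functions split into the two
    coordinates. *)
Definition near (p : pt) (r : R) (q : pt) : Prop :=
  Rabs (fst q - fst p) < r /\ Rabs (snd q - snd p) < r.

Lemma near_dist2 p q r : dist2 p q < r -> near p r q.
Proof.
  unfold dist2, near. intros H. split; (eapply Rle_lt_trans; [|exact H]);
  rewrite <- sqrt_Rsqr_abs; apply sqrt_le_1_alt; unfold Rsqr;
  pose proof (pow2_ge_0 (fst p - fst q)); pose proof (pow2_ge_0 (snd p - snd q)); simpl in *; lra.
Qed.

Lemma dist2_near p q r : near p (r / 2) q -> dist2 p q < r.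
Proof.
  intros [H1 H2]. unfold dist2.
  set (x := fst p - fst q). set (y := snd p - snd q).
  rewrite Rabs_minus_sym in H1, H2. fold x in H1. fold y in H2.
  pose proof (Rabs_pos x); pose proof (Rabs_pos y).
  apply Rle_lt_trans with (Rabs x + Rabs y); [|lra].
  rewrite <- (sqrt_Rsqr (Rabs x + Rabs y)) by lra. apply sqrt_le_1_alt.
  unfold Rsqr. rewrite <- (pow2_abs x), <- (pow2_abs y). simpl.
  assert (0 <= Rabs x * Rabs y) by (apply Rmult_le_pos; assumption). lra.
Qed.

Lemma near_refl p r : 0 < r -> near p r p.
Proof. intros; split; rewrite Rminus_diag, Rabs_R0; assumption. Qed.

Lemma near_weaken p r r' q : r <= r' -> near p r q -> near p r' q.
Proof. intros H [H1 H2]; split; lra. Qed.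

Lemma near_trans p q w r s : near p r q -> near q s w -> near p (r + s) w.
Proof.
  intros [A1 A2] [B1 B2]; split.
  - replace (fst w - fst p) with ((fst w - fst q) + (fst q - fst p)) by ring.
    eapply Rle_lt_trans; [apply Rabs_triang | lra].
  - replace (snd w - snd p) with ((snd w - snd q) + (snd q - snd p)) by ring.
    eapply Rle_lt_trans; [apply Rabs_triang | lra].
Qed.

Lemma interior_near S p : r2_interior S p <-> exists r, 0 < r /\ forall q, near p r q -> S q.
Proof.
  split; intros [r [Hr H]].
  - exists (r / 2); split; [lra|]. intros q Hq; apply H, dist2_near, Hq.
  - exists r; split; [exact Hr|]. intros q Hq; apply H, near_dist2, Hq.
Qed.

Lemma closure_near S p : r2_closure S p <-> forall r, 0 < r -> exists q, S q /\ near p r q.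
Proof.
  split; intros H r Hr.
  - destruct (H r Hr) as [q [Hq Hd]]. exists q; split; [exact Hq | apply near_dist2, Hd].
  - destruct (H (r / 2)) as [q [Hq Hd]]; [lra|]. exists q; split; [exact Hq | apply dist2_near, Hd].
Qed.

Lemma open_near W : is_open W <-> forall p, W p -> exists r, 0 < r /\ forall q, near p r q -> W q.
Proof.
  split; intros H p Hp; apply interior_near, H, Hp.
Qed.

Lemma interior_open S : is_open (r2_interior S).
Proof.
  apply open_near. intros p Hp. apply interior_near in Hp as [r [Hr H]].
  exists (r / 2); split; [lra|]. intros q Hq. apply interior_near.
  exists (r / 2); split; [lra|]. intros w Hw. apply H.
  replace r with (r / 2 + r / 2) by lra. eapply near_trans; eassumption.
Qed.

Lemma interior_sub S p : r2_interior S p -> S p.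
Proof. intros H. apply interior_near in H as [r [Hr H]]. apply H, near_refl, Hr. Qed.

Lemma closure_mono S T p : (forall q, S q -> T q) -> r2_closure S p -> r2_closure T p.
Proof. intros H Hp r Hr. destruct (Hp r Hr) as [q [Hq Hd]]. exists q; auto. Qed.

Lemma closure_sub (S : region) p : S p -> r2_closure S p.
Proof. intros H. apply closure_near. intros r Hr. exists p; split; [exact H | apply near_refl, Hr]. Qed.

Definition comb (t : R) (p q : pt) : pt :=
  ((1 - t) * fst p + t * fst q, (1 - t) * snd p + t * snd q).

(** A point [w] near [comb t q z] equals [comb t q' z'] with [q'] in [S] near [q]; then [z'] is
    within [r] of [z], the factor [t] in the radius paying for the division by [t]. *)
Lemma interior_segment S q z t :
  is_convex S -> r2_closure S q -> r2_interior S z -> 0 < t <= 1 ->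
  r2_interior S (comb t q z).
Proof.
  intros HS Hq Hz Ht. apply interior_near in Hz as [r [Hr Hz]].
  apply interior_near. exists (t * r / 2). split; [nra|]. intros w [Hw1 Hw2].
  assert (Hd : 0 < t * r / 2) by nra.
  rewrite closure_near in Hq. destruct (Hq _ Hd) as [q' [HSq' [Hq1 Hq2]]].
  set (z' := ((fst w - (1 - t) * fst q') / t, (snd w - (1 - t) * snd q') / t)).
  assert (Ez : comb t q' z' = w).
  { unfold comb, z'; simpl. destruct w; simpl; f_equal; field; lra. }
  rewrite <- Ez. apply HS; [exact HSq' | | lra].
  apply Hz.
  assert (G : forall a b c d, Rabs (a - ((1 - t) * b + t * c)) < t * r / 2 -> Rabs (d - b) < t * r / 2 ->
             Rabs ((a - (1 - t) * d) / t - c) < r).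
  { intros a b c d H1 H2. apply Rabs_def2 in H1, H2.
    replace ((a - (1 - t) * d) / t - c) with ((a - ((1 - t) * b + t * c) - (1 - t) * (d - b)) / t)
      by (field; lra).
    unfold Rdiv. rewrite Rabs_mult, Rabs_inv, (Rabs_right t) by lra.
    apply (Rmult_lt_reg_r t); [lra|]. rewrite Rmult_assoc, Rinv_l, Rmult_1_r by lra.
    set (e := t * r / 2) in *. replace (r * t) with (e + e) by (unfold e; field).
    destruct H1 as [H1 H1'], H2 as [H2 H2'].
    assert (0 <= (1 - t) * (e - (d - b))) by (apply Rmult_le_pos; lra).
    assert (0 <= (1 - t) * (e + (d - b))) by (apply Rmult_le_pos; lra).
    assert (0 < t * e) by (apply Rmult_lt_0_compat; lra).
    apply Rabs_def1; lra. }
  split; [exact (G _ _ _ _ Hw1 Hq1) | exact (G _ _ _ _ Hw2 Hq2)].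
Qed.

Lemma interior_convex S : is_convex S -> is_convex (r2_interior S).
Proof.
  intros HS p q t Hp Hq Ht. change (r2_interior S (comb t p q)).
  destruct (Req_dec t 0) as [->|Hn].
  - replace (comb 0 p q) with p; [exact Hp|]. unfold comb; destruct p; simpl; f_equal; ring.
  - apply interior_segment; [exact HS | apply closure_sub, interior_sub, Hp | exact Hq | lra].
Qed.

Lemma comb_near p q s r :
  0 < r -> exists e, 0 < e /\ forall t, Rabs (t - s) < e -> near (comb s p q) r (comb t p q).
Proof.
  intros Hr. set (D := Rabs (fst q - fst p) + Rabs (snd q - snd p) + 1).
  assert (H1 := Rabs_pos (fst q - fst p)). assert (H2 := Rabs_pos (snd q - snd p)).
  exists (r / D). split; [apply Rdiv_lt_0_compat; unfold D; lra|].
  intros t Ht. unfold near, comb; simpl.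
  assert (Ht' : Rabs (t - s) * D < r).
  { apply (Rmult_lt_compat_r D) in Ht; [|unfold D; lra].
    unfold Rdiv in Ht; rewrite Rmult_assoc, Rinv_l in Ht by (unfold D; lra). lra. }
  assert (H3 := Rabs_pos (t - s)). unfold D in Ht'.
  split.
  - replace (_ - _) with ((t - s) * (fst q - fst p)) by ring. rewrite Rabs_mult. nra.
  - replace (_ - _) with ((t - s) * (snd q - snd p)) by ring. rewrite Rabs_mult. nra.
Qed.

(** On a segment from a point of [V] to a point of [W], the supremum of the parameters up to which
    the segment stays in [V] can belong to neither open set. *)
Lemma convex_connected S : is_convex S -> connected S.
Proof.
  intros HS [V [W [HV [HW [Hcov [[p [Sp Vp]] [[q [Sq Wq]] Hdis]]]]]]].
  rewrite open_near in HV, HW.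
  assert (HSc : forall t, 0 <= t <= 1 -> S (comb t p q)) by (intros t Ht; apply HS; auto).
  assert (E0 : comb 0 p q = p) by (unfold comb; destruct p; simpl; f_equal; ring).
  assert (E1 : comb 1 p q = q) by (unfold comb; destruct q; simpl; f_equal; ring).
  set (E := fun s => 0 <= s <= 1 /\ forall t, 0 <= t <= s -> V (comb t p q)).
  destruct (completeness E) as [s [Hub Hlub]].
  { exists 1. intros x [Hx _]; lra. }
  { exists 0. split; [lra|]. intros t Ht. replace t with 0 by lra. rewrite E0; exact Vp. }
  assert (Hs0 : 0 <= s).
  { apply Hub. split; [lra|]. intros t Ht. replace t with 0 by lra. rewrite E0; exact Vp. }
  assert (Hs1 : s <= 1) by (apply Hlub; intros x [Hx _]; lra).
  assert (Hbelow : forall t, 0 <= t < s -> V (comb t p q)).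
  { intros t Ht. apply NNPP; intros Hno.
    assert (s <= t); [|lra]. apply Hlub. intros x [Hx HxV].
    destruct (Rle_lt_dec x t); [assumption|]. destruct Hno. apply HxV; lra. }
  destruct (Hcov _ (HSc s (conj Hs0 Hs1))) as [HsV|HsW].
  - destruct (HV _ HsV) as [r [Hr Hball]]. destruct (comb_near p q s r Hr) as [e [He Hcomb]].
    destruct (Rlt_le_dec s 1) as [Hlt|Hge].
    + set (s' := s + Rmin (e / 2) (1 - s)).
      assert (Hm : 0 < Rmin (e / 2) (1 - s)) by (apply Rmin_glb_lt; lra).
      assert (Hm1 := Rmin_l (e / 2) (1 - s)). assert (Hm2 := Rmin_r (e / 2) (1 - s)).
      assert (s' <= s); [|unfold s' in *; lra]. apply Hub. split; [unfold s'; lra|].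
      intros t Ht. destruct (Rlt_le_dec t s); [apply Hbelow; lra|].
      apply Hball, Hcomb. unfold s' in Ht. apply Rabs_def1; lra.
    + replace s with 1 in HsV by lra. rewrite E1 in HsV. apply (Hdis q); assumption.
  - destruct (HW _ HsW) as [r [Hr Hball]]. destruct (comb_near p q s r Hr) as [e [He Hcomb]].
    destruct (Req_dec s 0) as [Hz|Hnz].
    + rewrite Hz, E0 in HsW. apply (Hdis p); assumption.
    + set (t := Rmax 0 (s - e / 2)).
      assert (Ht : 0 <= t < s /\ s - e / 2 <= t).
      { unfold t. split; [split; [apply Rmax_l | apply Rmax_lub_lt; lra] | apply Rmax_r]. }
      apply (Hdis (comb t p q)); [apply HSc; lra | apply Hbelow; lra |].
      apply Hball, Hcomb. apply Rabs_def1; lra.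
Qed.

(* Coordinates along and across the ray from [q] to an interior point [z]: the slopes seen on the
   two sides of the ray are separated, and their supremum on one side gives the line. *)
Lemma supporting_line (U : region) q z :
  is_convex U -> is_open U -> U z -> ~ U q ->
  exists u1 u2, (u1 <> 0 \/ u2 <> 0) /\
    forall w, U w -> 0 <= u1 * (fst w - fst q) + u2 * (snd w - snd q).
Proof.
  intros Hconv Hop Hz Hq. rewrite open_near in Hop.
  set (X := fst z - fst q). set (Y := snd z - snd q).
  set (al := fun w : pt => X * (fst w - fst q) + Y * (snd w - snd q)).
  set (be := fun w : pt => - Y * (fst w - fst q) + X * (snd w - snd q)).
  set (n2 := X * X + Y * Y).
  assert (Hn : 0 < n2).
  { destruct (Req_dec X 0) as [EX|EX]; [destruct (Req_dec Y 0) as [EY|EY]|].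
    - destruct Hq. replace q with z; [exact Hz|]. unfold X, Y in EX, EY.
      destruct z, q; simpl in *; f_equal; lra.
    - unfold n2; nra.
    - unfold n2; nra. }
  (* A point of [U] on the line through [q] and [z] but not on the side of [z] would put [q] on a
     segment inside [U]. *)
  assert (Hax : forall v, U v -> be v = 0 -> 0 < al v).
  { intros v Hv Hb. destruct (Rlt_le_dec 0 (al v)) as [|Hle]; [assumption|]. destruct Hq.
    set (s := - al v / (n2 - al v)).
    replace q with (comb s v z).
    { apply Hconv; [exact Hv | exact Hz |]. unfold s. split.
      - apply Rmult_le_pos; [lra | left; apply Rinv_0_lt_compat; lra].
      - apply (Rmult_le_reg_r (n2 - al v)); [lra|].
        unfold Rdiv; rewrite Rmult_assoc, Rinv_l by lra. lra. }
    assert (E1 : n2 * (fst v - fst q) = al v * X).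
    { transitivity (al v * X - Y * be v); [unfold be, al, n2; ring | rewrite Hb; ring]. }
    assert (E2 : n2 * (snd v - snd q) = al v * Y).
    { transitivity (al v * Y + X * be v); [unfold be, al, n2; ring | rewrite Hb; ring]. }
    assert (Hs : (1 - s) * al v + s * n2 = 0) by (unfold s; field; lra).
    assert (F1 : n2 * (fst (comb s v z) - fst q) = 0).
    { unfold comb; simpl. transitivity ((1 - s) * (n2 * (fst v - fst q)) + s * n2 * X); [unfold X; ring|].
      rewrite E1. transitivity (X * ((1 - s) * al v + s * n2)); [ring | rewrite Hs; ring]. }
    assert (F2 : n2 * (snd (comb s v z) - snd q) = 0).
    { unfold comb; simpl. transitivity ((1 - s) * (n2 * (snd v - snd q)) + s * n2 * Y); [unfold Y; ring|].
      rewrite E2. transitivity (Y * ((1 - s) * al v + s * n2)); [ring | rewrite Hs; ring]. }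
    apply Rmult_integral in F1 as [F1|F1]; [lra|]. apply Rmult_integral in F2 as [F2|F2]; [lra|].
    destruct (comb s v z), q; simpl in *; f_equal; lra. }
  (* The segment from [w] to [w'] crosses the axis [be = 0] inside [U], hence where [al] is
     positive. *)
  assert (Hsep : forall w w', U w -> U w' -> 0 < be w -> be w' < 0 -> al w' / be w' <= al w / be w).
  { intros w w' Hw Hw' Hb Hb'.
    set (t := be w / (be w - be w')).
    assert (Ht : 0 <= t <= 1).
    { unfold t; split; [apply Rmult_le_pos; [lra | left; apply Rinv_0_lt_compat; lra]|].
      apply (Rmult_le_reg_r (be w - be w')); [lra|].
      unfold Rdiv; rewrite Rmult_assoc, Rinv_l by lra. lra. }
    assert (Ht' : (1 - t) * be w + t * be w' = 0) by (unfold t; field; lra).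
    assert (Hv := Hax _ (Hconv w w' t Hw Hw' Ht)).
    assert (Hlin : be (comb t w w') = (1 - t) * be w + t * be w') by (unfold be, comb; simpl; ring).
    assert (Hlin' : al (comb t w w') = (1 - t) * al w + t * al w') by (unfold al, comb; simpl; ring).
    unfold comb in Hlin, Hlin'. rewrite Hlin, Hlin' in Hv. specialize (Hv Ht').
    assert (Hv' : 0 < - be w' * al w + be w * al w').
    { apply (Rmult_lt_compat_r (be w - be w')) in Hv; [|lra]. unfold t in Hv.
      replace (((1 - be w / (be w - be w')) * al w + be w / (be w - be w') * al w') * (be w - be w'))
        with (- be w' * al w + be w * al w') in Hv by (field; lra). lra. }
    assert (0 <= al w / be w - al w' / be w'); [|lra].
    replace (al w / be w - al w' / be w') with ((- be w' * al w + be w * al w') / (be w * - be w'))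
      by (field; lra).
    apply Rmult_le_pos; [lra|]. left; apply Rinv_0_lt_compat. nra. }
  destruct (Hop z Hz) as [r [Hr Hball]].
  (* A sideways step short enough to stay in [U]; the two resulting points show that slopes exist on
     both sides. *)
  set (e := r / (2 * (Rabs X + Rabs Y + 1))).
  assert (HX := Rabs_pos X). assert (HY := Rabs_pos Y).
  assert (He : 0 < e) by (unfold e; apply Rdiv_lt_0_compat; lra).
  assert (Her : e * (Rabs X + Rabs Y + 1) < r).
  { unfold e. replace (_ * _) with (r / 2) by (field; lra). lra. }
  assert (Hside : forall sg, Rabs sg = 1 -> U (fst z - sg * e * Y, snd z + sg * e * X)).
  { intros sg Hsg. apply Hball. split; simpl.
    - replace (_ - _) with (- (sg * e * Y)) by ring.
      rewrite Rabs_Ropp, !Rabs_mult, Hsg, (Rabs_right e) by lra. nra.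
    - replace (_ - _) with (sg * e * X) by ring.
      rewrite !Rabs_mult, Hsg, (Rabs_right e) by lra. nra. }
  assert (Hp := Hside 1 ltac:(apply Rabs_R1)).
  assert (Hm := Hside (-1) ltac:(rewrite Rabs_left; lra)).
  assert (Hpb : 0 < be (fst z - 1 * e * Y, snd z + 1 * e * X)).
  { unfold be; simpl. fold X Y. replace (_ + _) with (e * n2) by (unfold n2, X, Y; ring). nra. }
  assert (Hmb : be (fst z - -1 * e * Y, snd z + -1 * e * X) < 0).
  { unfold be; simpl. replace (_ + _) with (- (e * n2)) by (unfold n2, X, Y; ring). nra. }
  destruct (completeness (fun x => exists w, U w /\ be w < 0 /\ x = al w / be w)) as [k [Hub Hlub]].
  { eexists. intros x [w [Hw [Hb ->]]]. apply Hsep; [exact Hp | exact Hw | exact Hpb | exact Hb]. }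
  { eexists. eexists. split; [exact Hm|]. split; [exact Hmb | reflexivity]. }
  (* The normal of the line [al = k * be], rewritten in the original coordinates. *)
  exists (X + k * Y), (Y - k * X).
  assert (Hform : forall w, (X + k * Y) * (fst w - fst q) + (Y - k * X) * (snd w - snd q) = al w - k * be w).
  { intros w; unfold al, be; ring. }
  split.
  - destruct (Req_dec (X + k * Y) 0) as [E1|]; [|auto]. right. intros E2.
    specialize (Hform z). rewrite E1, E2 in Hform. unfold al, be in Hform. fold X Y in Hform.
    unfold n2 in Hn. lra.
  - intros w Hw. rewrite Hform. destruct (Rtotal_order (be w) 0) as [Hb|[Hb|Hb]].
    + assert (H : al w / be w <= k) by (apply Hub; exists w; auto).
      replace (al w) with (al w / be w * be w) by (field; lra). nra.
    + rewrite Hb. specialize (Hax w Hw Hb). lra.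
    + assert (H : k <= al w / be w).
      { apply Hlub. intros x [w' [Hw' [Hb' ->]]]. apply Hsep; assumption. }
      replace (al w) with (al w / be w * be w) by (field; lra). nra.
Qed.

(** * Lattice directions and minimizers of linear functions *)

(** Pigeonhole: among [K + 1] multiples of [x], two have fractional parts in the same of [K]
    intervals of length [1 / K < delta]. *)
Lemma dirichlet (x delta : R) :
  0 < delta -> exists (N : nat) (m : Z), (1 <= N)%nat /\ Rabs (INR N * x - IZR m) <= delta.
Proof.
  intros Hd. destruct (INR_unbounded (/ delta)) as [K0 HK0].
  set (K := S K0).
  assert (HK : / delta < INR K) by (unfold K; rewrite S_INR; lra).
  assert (HKp : 0 < INR K) by (apply lt_0_INR; unfold K; lia).
  set (fr := fun k : nat => INR k * x - IZR (Int_part (INR k * x))).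
  assert (Hfr : forall k, 0 <= fr k < 1).
  { intros k; unfold fr. destruct (base_Int_part (INR k * x)); lra. }
  set (bin := fun k => Z.to_nat (Int_part (INR K * fr k))).
  assert (Hbin0 : forall k, (0 <= Int_part (INR K * fr k))%Z).
  { intros k. destruct (base_Int_part (INR K * fr k)) as [_ H].
    assert (0 <= INR K * fr k) by (apply Rmult_le_pos; [lra | apply Hfr]).
    assert (H' : -1 < IZR (Int_part (INR K * fr k))) by lra. apply lt_IZR in H'. lia. }
  assert (Hbin : forall k, INR (bin k) <= INR K * fr k < INR (bin k) + 1).
  { intros k. unfold bin. rewrite INR_IZR_INZ, Z2Nat.id by apply Hbin0.
    destruct (base_Int_part (INR K * fr k)); lra. }
  assert (Hex : exists i j, (i < j)%nat /\ bin i = bin j).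
  { apply NNPP; intros Hno.
    assert (Hnd : NoDup (map bin (seq 0 (S K)))).
    { apply NoDup_map_NoDup_ForallPairs; [|apply seq_NoDup]. intros i j _ _ E.
      destruct (Nat.lt_trichotomy i j) as [H|[H|H]]; [|exact H|]; destruct Hno; eauto. }
    apply NoDup_incl_length with (l' := seq 0 K) in Hnd.
    - rewrite length_map, !length_seq in Hnd. lia.
    - intros b Hb. apply in_map_iff in Hb as [k [<- _]]. apply in_seq. split; [lia|].
      apply INR_lt. rewrite Nat.add_0_l. destruct (Hbin k) as [H _]. destruct (Hfr k) as [_ Hf].
      apply (Rmult_lt_compat_l (INR K)) in Hf; lra. }
  destruct Hex as [i [j [Hij E]]].
  exists (j - i)%nat, (Int_part (INR j * x) - Int_part (INR i * x))%Z. split; [lia|].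
  rewrite minus_INR, minus_IZR by lia.
  replace (_ - _) with (fr j - fr i) by (unfold fr; ring).
  pose proof (Hbin i) as Hi. pose proof (Hbin j) as Hj. rewrite E in Hi.
  assert (H1 : INR K * Rabs (fr j - fr i) <= 1).
  { rewrite <- (Rabs_right (INR K)) at 1 by lra. rewrite <- Rabs_mult. apply Rabs_le.
    rewrite Rmult_minus_distr_l. lra. }
  apply (Rmult_le_reg_l (INR K)); [exact HKp|].
  apply Rle_trans with 1; [exact H1|].
  apply (Rmult_lt_compat_r delta) in HK; [|exact Hd]. rewrite Rinv_l in HK by lra. lra.
Qed.

(** An approximation finer by the factor [S T], multiplied by [S T], has a large denominator and
    still error at most [delta]. *)
Lemma dirichlet_large (x delta : R) (T : nat) :
  0 < delta -> exists (N : nat) (m : Z), (T < N)%nat /\ Rabs (INR N * x - IZR m) <= delta.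
Proof.
  intros Hd. assert (HT : 0 < INR (S T)) by (apply lt_0_INR; lia).
  destruct (dirichlet x (delta / INR (S T))) as [N [m [HN Hm]]].
  { apply Rdiv_lt_0_compat; assumption. }
  exists (S T * N)%nat, (Z.of_nat (S T) * m)%Z. split; [nia|].
  rewrite mult_INR, mult_IZR, <- INR_IZR_INZ.
  replace (_ - _) with (INR (S T) * (INR N * x - IZR m)) by ring.
  rewrite Rabs_mult, (Rabs_right (INR (S T))) by lra.
  apply (Rmult_le_compat_l (INR (S T))) in Hm; [|lra].
  replace (INR (S T) * (delta / INR (S T))) with delta in Hm by (field; lra). exact Hm.
Qed.

(** Substitutes for a real normal [u] that no integer vector need be parallel to. A nonzero
    coordinate of [u] is matched exactly by plus or minus [N], the other by approximating the
    quotient with denominator [N]. *)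
Lemma lattice_direction u1 u2 delta T :
  u1 <> 0 \/ u2 <> 0 -> 0 < delta ->
  exists (a : mono) (t : R), 0 < t /\
    Rabs (IZR (fst a) - t * u1) <= delta /\ Rabs (IZR (snd a) - t * u2) <= delta /\
    (T <= Rabs (IZR (fst a)) \/ T <= Rabs (IZR (snd a))).
Proof.
  intros Hu Hd.
  assert (G : forall v1 v2, v1 <> 0 -> exists i j t, 0 < t /\ Rabs (IZR i - t * v1) <= delta /\
            Rabs (IZR j - t * v2) <= delta /\ T <= Rabs (IZR i)).
  { intros v1 v2 Hv. destruct (INR_unbounded T) as [T0 HT0].
    destruct (dirichlet_large (v2 / v1) delta T0 Hd) as [N [m [HN Hm]]].
    assert (HN0 : 0 < INR N) by (apply lt_0_INR; lia).
    apply lt_INR in HN.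
    assert (exists sg : Z, v1 = IZR sg * Rabs v1 /\ Rabs (IZR sg) = 1) as [sg [Hs1 Hs2]].
    { destruct (Rlt_le_dec v1 0).
      - exists (-1)%Z. rewrite Rabs_left by assumption. split; [ring|].
        rewrite Rabs_left by lra. ring.
      - exists 1%Z. rewrite Rabs_right by lra. split; [ring|]. apply Rabs_R1. }
    assert (Hv' : 0 < Rabs v1) by (apply Rabs_pos_lt; exact Hv).
    exists (sg * Z.of_nat N)%Z, (sg * m)%Z, (INR N / Rabs v1).
    rewrite !mult_IZR, <- INR_IZR_INZ.
    assert (Hsg : IZR sg * IZR sg = 1).
    { rewrite <- (Rabs_right (IZR sg * IZR sg)) by apply Rle_ge, Rle_0_sqr.
      rewrite Rabs_mult, Hs2; ring. }
    split; [|split; [|split]].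
    - apply Rdiv_lt_0_compat; assumption.
    - rewrite Hs1 at 2. replace (_ - _) with 0 by (field; lra). rewrite Rabs_R0; lra.
    - replace (IZR sg * IZR m - INR N / Rabs v1 * v2) with (- IZR sg * (INR N * (v2 / v1) - IZR m)).
      + rewrite Rabs_mult, Rabs_Ropp, Hs2. lra.
      + assert (Hs0 : IZR sg <> 0) by (intros E; rewrite E in Hsg; lra).
        replace (v2 / v1) with (IZR sg * (v2 / Rabs v1)).
        * transitivity (IZR sg * IZR m - (IZR sg * IZR sg) * (INR N * (v2 / Rabs v1))); [ring|].
          rewrite Hsg. unfold Rdiv. ring.
        * rewrite Hs1 at 2. apply (Rmult_eq_reg_l (IZR sg)); [|exact Hs0].
          rewrite <- Rmult_assoc, Hsg. field. split; lra.
    - rewrite Rabs_mult, Hs2, (Rabs_right (INR N)) by lra. lra. }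
  destruct Hu as [Hu|Hu].
  - destruct (G u1 u2 Hu) as [i [j [t [H1 [H2 [H3 H4]]]]]]. exists (i, j), t. simpl; auto.
  - destruct (G u2 u1 Hu) as [i [j [t [H1 [H2 [H3 H4]]]]]]. exists (j, i), t. simpl; auto.
Qed.

(** Compactness by two suprema, in the orthogonal coordinates [g] and [h]: [- m] is the infimum of
    [g], and [x] is the largest value that [h] approaches while [g] tends to [- m]. The point with
    these coordinates is a limit of points of [U]. *)
Lemma linear_min (U : region) M (A B : R) :
  (forall w, U w -> Rabs (fst w) <= M /\ Rabs (snd w) <= M) -> (exists w, U w) ->
  A <> 0 \/ B <> 0 ->
  exists q, r2_closure U q /\ forall w, U w -> A * fst q + B * snd q <= A * fst w + B * snd w.
Proof.
  intros HM [w0 Hw0] HAB.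
  set (g := fun w : pt => A * fst w + B * snd w).
  set (h := fun w : pt => - B * fst w + A * snd w).
  set (C := (Rabs A + Rabs B) * M).
  assert (Hbd : forall w, U w -> - C <= g w <= C /\ - C <= h w <= C).
  { intros w Hw. destruct (HM w Hw) as [H1 H2].
    assert (G : forall x y, Rabs (x * fst w + y * snd w) <= (Rabs x + Rabs y) * M).
    { intros x y. eapply Rle_trans; [apply Rabs_triang|]. rewrite !Rabs_mult.
      pose proof (Rabs_pos x); pose proof (Rabs_pos y). nra. }
    split; apply Rabs_le_inv; unfold C; [apply G|].
    rewrite (Rplus_comm (Rabs A)), <- (Rabs_Ropp B). apply G. }
  destruct (completeness (fun x => exists w, U w /\ x = - g w)) as [m [Hmub Hmlub]].
  { exists C. intros x [w [Hw ->]]. destruct (Hbd w Hw); lra. }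
  { exists (- g w0), w0; auto. }
  assert (Happ : forall eps, 0 < eps -> exists w, U w /\ g w < - m + eps).
  { intros eps He. apply NNPP; intros Hno. assert (m <= m - eps); [|lra].
    apply Hmlub. intros x [w [Hw ->]]. destruct (Rlt_le_dec (g w) (- m + eps)); [|lra].
    destruct Hno; eauto. }
  destruct (completeness (fun x => forall eps, 0 < eps -> exists w, U w /\ g w < - m + eps /\ x <= h w))
    as [x [Hxub Hxlub]].
  { exists C. intros y Hy. destruct (Hy 1) as [w [Hw [_ H]]]; [lra|]. destruct (Hbd w Hw); lra. }
  { exists (- C). intros eps He. destruct (Happ eps He) as [w [Hw H]]. exists w.
    destruct (Hbd w Hw); repeat split; auto; lra. }
  assert (Hcl : forall eps, 0 < eps -> exists w, U w /\ Rabs (g w + m) < eps /\ Rabs (h w - x) < eps).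
  { intros eps He.
    assert (exists e1, 0 < e1 /\ forall w, U w -> g w < - m + e1 -> h w < x + eps / 2) as [e1 [He1 H1]].
    { apply NNPP; intros Hno. assert (x + eps / 2 <= x); [|lra]. apply Hxub.
      intros e1 He1. apply NNPP; intros Hno'. apply Hno. exists e1. split; [exact He1|].
      intros w Hw Hg. destruct (Rlt_le_dec (h w) (x + eps / 2)); [assumption|].
      destruct Hno'; exists w; auto. }
    assert (exists y, x - eps / 2 < y /\
        forall eps, 0 < eps -> exists w, U w /\ g w < - m + eps /\ y <= h w) as [y [Hy Hy']].
    { apply NNPP; intros Hno. assert (x <= x - eps / 2); [|lra]. apply Hxlub.
      intros y Hy. destruct (Rlt_le_dec (x - eps / 2) y); [|assumption]. destruct Hno; eauto. }
    destruct (Hy' (Rmin e1 (eps / 2))) as [w [Hw [Hg Hh]]]; [apply Rmin_glb_lt; lra|].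
    assert (Ha := Rmin_l e1 (eps / 2)). assert (Hb := Rmin_r e1 (eps / 2)).
    assert (- g w <= m) by (apply Hmub; eauto).
    specialize (H1 w Hw ltac:(lra)).
    exists w; split; [exact Hw|]. split; apply Rabs_def1; lra. }
  (* The matrix taking a point to [(g, h)] has determinant [D]; its inverse gives the witness. *)
  set (D := A * A + B * B).
  assert (HD : 0 < D) by (unfold D; destruct HAB; nra).
  exists ((A * - m - B * x) / D, (B * - m + A * x) / D). split.
  - apply closure_near. intros r Hr.
    set (C' := Rabs A + Rabs B + 1).
    pose proof (Rabs_pos A) as HA0; pose proof (Rabs_pos B) as HB0.
    destruct (Hcl (r * D / C')) as [w [Hw [Hg Hh]]].
    { apply Rdiv_lt_0_compat; [nra | unfold C'; lra]. }
    exists w; split; [exact Hw|].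
    assert (Hfin : forall a b, Rabs a + Rabs b < C' ->
                     Rabs (a * (g w + m) + b * (h w - x)) < r * D).
    { intros a b Hab. eapply Rle_lt_trans; [apply Rabs_triang|]. rewrite !Rabs_mult.
      pose proof (Rabs_pos a); pose proof (Rabs_pos b).
      assert (HC' : r * D / C' * C' = r * D) by (field; unfold C'; lra).
      assert (0 < r * D / C') by (apply Rdiv_lt_0_compat; [nra | unfold C'; lra]).
      pose proof (Rabs_pos (g w + m)); pose proof (Rabs_pos (h w - x)). nra. }
    split; simpl.
    + replace (_ - _) with ((A * (g w + m) + - B * (h w - x)) / D).
      * unfold Rdiv. rewrite Rabs_mult, Rabs_inv, (Rabs_right D) by lra.
        apply (Rmult_lt_reg_r D); [exact HD|]. rewrite Rmult_assoc, Rinv_l, Rmult_1_r by lra.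
        apply Hfin. rewrite Rabs_Ropp. unfold C'; lra.
      * unfold g, h, D. field. fold D; lra.
    + replace (_ - _) with ((B * (g w + m) + A * (h w - x)) / D).
      * unfold Rdiv. rewrite Rabs_mult, Rabs_inv, (Rabs_right D) by lra.
        apply (Rmult_lt_reg_r D); [exact HD|]. rewrite Rmult_assoc, Rinv_l, Rmult_1_r by lra.
        apply Hfin. unfold C'; lra.
      * unfold g, h, D. field. fold D; lra.
  - intros w Hw. simpl.
    replace (_ + _) with (- m) by (unfold D; field; fold D; lra).
    assert (- g w <= m) by (apply Hmub; eauto). unfold g in *; lra.
Qed.

(** * Minima of integral affine functions *)

Lemma ev_near a z r w :
  near z r w -> Rabs (ev a w - ev a z) <= (Rabs (IZR (fst a)) + Rabs (IZR (snd a))) * r.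
Proof.
  intros [H1 H2]. unfold ev.
  replace (_ - _) with (IZR (fst a) * (fst w - fst z) + IZR (snd a) * (snd w - snd z)) by ring.
  eapply Rle_trans; [apply Rabs_triang|]. rewrite !Rabs_mult.
  pose proof (Rabs_pos (IZR (fst a))); pose proof (Rabs_pos (IZR (snd a))). nra.
Qed.

Lemma ev_comb a t p q : ev a (comb t p q) = (1 - t) * ev a p + t * ev a q.
Proof. unfold ev, comb; simpl; ring. Qed.

Definition is_support (U : region) (d : mono -> R) : Prop :=
  forall a, is_lub (fun x => exists w, U w /\ x = - ev a w) (d a).

Lemma support_exists (U : region) M :
  (forall w, U w -> Rabs (fst w) <= M /\ Rabs (snd w) <= M) -> (exists w, U w) ->
  exists d, is_support U d.
Proof.
  intros HM [w0 Hw0].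
  assert (Hb : forall a, bound (fun x => exists w, U w /\ x = - ev a w)).
  { intros a. exists ((Rabs (IZR (fst a)) + Rabs (IZR (snd a))) * M).
    intros x [w [Hw ->]]. destruct (HM w Hw) as [H1 H2].
    apply Rle_trans with (Rabs (- ev a w)); [apply Rle_abs|]. rewrite Rabs_Ropp. unfold ev.
    eapply Rle_trans; [apply Rabs_triang|]. rewrite !Rabs_mult.
    pose proof (Rabs_pos (IZR (fst a))); pose proof (Rabs_pos (IZR (snd a))). nra. }
  assert (Hn : forall a, exists x, exists w, U w /\ x = - ev a w) by (intros a; eauto).
  exists (fun a => proj1_sig (completeness _ (Hb a) (Hn a))).
  intros a. exact (proj2_sig (completeness _ (Hb a) (Hn a))).
Qed.

Lemma affine_closure (S : region) k A B q :
  (forall z, S z -> 0 <= k + A * fst z + B * snd z) -> r2_closure S q ->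
  0 <= k + A * fst q + B * snd q.
Proof.
  intros H Hq. rewrite closure_near in Hq.
  destruct (Rle_lt_dec 0 (k + A * fst q + B * snd q)) as [|Hlt]; [assumption|]. exfalso.
  pose proof (Rabs_pos A); pose proof (Rabs_pos B).
  set (e := - (k + A * fst q + B * snd q) / (Rabs A + Rabs B + 1)).
  assert (He : 0 < e) by (unfold e; apply Rdiv_lt_0_compat; lra).
  assert (Hee : e * (Rabs A + Rabs B + 1) = - (k + A * fst q + B * snd q)) by (unfold e; field; lra).
  destruct (Hq e He) as [z [Hz [N1 N2]]]. specialize (H z Hz).
  assert (Rabs (A * (fst z - fst q)) <= Rabs A * e) by (rewrite Rabs_mult; nra).
  assert (Rabs (B * (snd z - snd q)) <= Rabs B * e) by (rewrite Rabs_mult; nra).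
  pose proof (Rle_abs (A * (fst z - fst q))). pose proof (Rle_abs (B * (snd z - snd q))). nra.
Qed.

Lemma support_ge U d a w : is_support U d -> U w -> 0 <= d a + ev a w.
Proof. intros H Hw. destruct (H a) as [Hub _]. assert (- ev a w <= d a) by (apply Hub; eauto). lra. Qed.

Lemma support_closure U d a q : is_support U d -> r2_closure U q -> 0 <= d a + ev a q.
Proof.
  intros H Hq. unfold ev. rewrite <- Rplus_assoc. apply (affine_closure U); [|exact Hq].
  intros z Hz. pose proof (support_ge U d a z H Hz). unfold ev in *; lra.
Qed.

(** A step of length [t] against the sign of one coordinate of [a] stays in [U], where [d a + ev a]
    is still nonnegative, and lowers [ev a] by [t] times that coordinate in absolute value. *)
Lemma support_growth U d z s t a :
  is_support U d -> (forall w, near z s w -> U w) -> 0 <= t < s ->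
  t * Rabs (IZR (fst a)) <= d a + ev a z /\ t * Rabs (IZR (snd a)) <= d a + ev a z.
Proof.
  intros Hd Hball Ht.
  assert (Hsg : forall x, exists sg, Rabs sg = 1 /\ sg * x = Rabs x).
  { intros x. destruct (Rle_lt_dec 0 x).
    - exists 1. rewrite Rabs_R1, (Rabs_right x) by lra. split; ring.
    - exists (-1). rewrite (Rabs_left (-1)), (Rabs_left x) by lra. split; ring. }
  assert (H0 : 0 < s) by lra.
  split.
  - destruct (Hsg (IZR (fst a))) as [sg [S1 S2]].
    assert (Hw : U (fst z - t * sg, snd z)).
    { apply Hball; split; simpl.
      - replace (_ - _) with (- (t * sg)) by ring. rewrite Rabs_Ropp, Rabs_mult, S1, Rabs_right; lra.
      - rewrite Rminus_diag, Rabs_R0; lra. }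
    pose proof (support_ge U d a _ Hd Hw) as H. unfold ev in *; simpl in H.
    replace (IZR (fst a) * (fst z - t * sg)) with (IZR (fst a) * fst z - t * (sg * IZR (fst a))) in H by ring.
    rewrite S2 in H. lra.
  - destruct (Hsg (IZR (snd a))) as [sg [S1 S2]].
    assert (Hw : U (fst z, snd z - t * sg)).
    { apply Hball; split; simpl.
      - rewrite Rminus_diag, Rabs_R0; lra.
      - replace (_ - _) with (- (t * sg)) by ring. rewrite Rabs_Ropp, Rabs_mult, S1, Rabs_right; lra. }
    pose proof (support_ge U d a _ Hd Hw) as H. unfold ev in *; simpl in H.
    replace (IZR (snd a) * (snd z - t * sg)) with (IZR (snd a) * snd z - t * (sg * IZR (snd a))) in H by ring.
    rewrite S2 in H. lra.
Qed.

Lemma Z_range_list (K : R) : exists l : list Z, forall z, Rabs (IZR z) <= K -> In z l.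
Proof.
  destruct (INR_unbounded K) as [N HN].
  exists (map (fun k => (Z.of_nat k - Z.of_nat N)%Z) (seq 0 (2 * N + 1))).
  intros z Hz. apply Rabs_le_inv in Hz. rewrite INR_IZR_INZ in HN.
  assert (H1 : IZR z < IZR (Z.of_nat N)) by lra.
  assert (H2 : IZR (- Z.of_nat N) < IZR z) by (rewrite opp_IZR; lra).
  apply lt_IZR in H1, H2. apply in_map_iff. exists (Z.to_nat (z + Z.of_nat N)).
  split; [lia|]. apply in_seq. lia.
Qed.

(** The growth bound holds with one constant on a whole neighbourhood, so a bound on the value
    bounds both exponents. Locally, a minimum over all monomials is thus a finite one. *)
Lemma local_finite U d z B :
  is_support U d -> is_open U -> U z ->
  exists s l, 0 < s /\ forall w, near z s w -> U w /\ forall b, d b + ev b w <= B -> In b l.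
Proof.
  intros Hd Ho Hz. rewrite open_near in Ho. destruct (Ho z Hz) as [r [Hr Hball]].
  destruct (Z_range_list (B / (r / 4))) as [l Hl].
  exists (r / 2), (list_prod l l). split; [lra|]. intros w Hw.
  split; [apply Hball; eapply near_weaken; [|exact Hw]; lra|].
  intros [i j] Hb.
  destruct (support_growth U d w (r / 2) (r / 4) (i, j) Hd) as [G1 G2]; [|lra|].
  { intros v Hv. apply Hball. replace r with (r / 2 + r / 2) by lra. eapply near_trans; eassumption. }
  assert (Hdiv : forall x, r / 4 * x <= d (i, j) + ev (i, j) w -> x <= B / (r / 4)).
  { intros x Hx. apply (Rmult_le_reg_l (r / 4)); [lra|].
    replace (r / 4 * (B / (r / 4))) with B by (field; lra). lra. }
  apply in_prod; apply Hl, Hdiv; assumption.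
Qed.

Lemma finite_radius {A} (l : list A) (P : A -> R -> Prop) :
  (forall x, In x l -> exists r, 0 < r /\ P x r) ->
  (forall x r r', 0 < r' <= r -> P x r -> P x r') ->
  exists r, 0 < r /\ forall x, In x l -> P x r.
Proof.
  intros Hex Hmono. induction l as [|x l IH].
  - exists 1. split; [lra | intros x []].
  - destruct IH as [r [Hr H]]; [auto with datatypes|].
    destruct (Hex x) as [r' [Hr' H']]; [auto with datatypes|].
    pose proof (Rmin_l r r'); pose proof (Rmin_r r r').
    assert (0 < Rmin r r') by (apply Rmin_glb_lt; assumption).
    exists (Rmin r r'). split; [assumption|].
    intros y [<-|Hy]; [apply (Hmono x r') | apply (Hmono y r)]; auto; lra.
Qed.

Lemma list_argmin {A} (phi : A -> R) (l : list A) x0 :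
  In x0 l -> exists x, In x l /\ forall y, In y l -> phi x <= phi y.
Proof.
  revert x0; induction l as [|y l IH]; intros x0 []; destruct l as [|y' l].
  1, 3: exists y; split; [left; reflexivity | intros z [<-|[]]; lra].
  all: destruct (IH y' (or_introl eq_refl)) as [x [Hx Hmin]];
    destruct (Rle_lt_dec (phi x) (phi y));
    [exists x; split; [right; exact Hx | intros z [<-|Hz]; auto]
    |exists y; split; [left; reflexivity | intros z [<-|Hz]; [lra | specialize (Hmin z Hz); lra]]].
Qed.

Lemma min_attained U d c z :
  is_support U d -> is_open U -> (forall a, d a <= c a) -> U z ->
  exists a, forall b, c a + ev a z <= c b + ev b z.
Proof.
  (* The zero monomial [o] supplies a value to compare with: larger ones cannot be minimal. *)
  intros Hd Ho Hc Hz. set (o := (0, 0)%Z : mono).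
  destruct (local_finite U d z (c o + ev o z) Hd Ho Hz) as [s [l [Hs Hl]]].
  destruct (Hl z (near_refl z s Hs)) as [_ Hfin].
  assert (Hin : In o l) by (apply Hfin; specialize (Hc o); lra).
  destruct (list_argmin (fun a => c a + ev a z) l o Hin) as [a [Ha Hmin]].
  exists a. intros b. destruct (Rle_lt_dec (c b + ev b z) (c o + ev o z)) as [H|H].
  - apply Hmin, Hfin. specialize (Hc b); lra.
  - specialize (Hmin o Hin). simpl in Hmin. lra.
Qed.

Definition face (U : region) (c : mono -> R) (a : mono) : region :=
  fun z => U z /\ forall b, b <> a -> c a + ev a z < c b + ev b z.

(** Near [z], monomials outside a finite list exceed [c a + ev a z + 1], a level that [a] itself
    does not reach; each monomial in the list keeps its strict inequality on some square. *)
Lemma face_open U d c a :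
  is_support U d -> is_open U -> (forall b, d b <= c b) -> is_open (face U c a).
Proof.
  intros Hd Ho Hc. apply open_near. intros z [Hz Hmin].
  set (na := fun b : mono => Rabs (IZR (fst b)) + Rabs (IZR (snd b))).
  assert (Hna : forall b, 0 <= na b).
  { intros b; unfold na. pose proof (Rabs_pos (IZR (fst b))); pose proof (Rabs_pos (IZR (snd b))); lra. }
  destruct (local_finite U d z (c a + ev a z + 1) Hd Ho Hz) as [s [l [Hs Hl]]].
  destruct (finite_radius l (fun b r => b <> a ->
      forall w, near z r w -> c a + ev a w < c b + ev b w)) as [r [Hr Hfin]].
  - intros b _. destruct (mono_eq_dec b a) as [E|E]; [exists 1; split; [lra | contradiction]|].
    specialize (Hmin b E). set (g := c b + ev b z - (c a + ev a z)).
    assert (Hg : 0 < g) by (unfold g; lra).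
    pose proof (Hna a) as N1. pose proof (Hna b) as N2.
    exists (g / (na a + na b + 1)). split; [apply Rdiv_lt_0_compat; lra|].
    intros _ w Hw. pose proof (ev_near a _ _ _ Hw) as B1. pose proof (ev_near b _ _ _ Hw) as B2.
    fold (na a) in B1. fold (na b) in B2. apply Rabs_le_inv in B1, B2.
    set (e := g / (na a + na b + 1)) in *.
    assert (He : e * (na a + na b + 1) = g) by (unfold e; field; lra).
    assert (0 < e) by (unfold e; apply Rdiv_lt_0_compat; lra). unfold g in He. lra.
  - intros b r r' Hr H Hb w Hw. apply H; [exact Hb|]. eapply near_weaken; [|exact Hw]; lra.
  - set (e := / (na a + 1)). pose proof (Hna a) as N1.
    assert (He : 0 < e) by (unfold e; apply Rinv_0_lt_compat; lra).
    assert (He1 : e * (na a + 1) = 1) by (unfold e; field; lra).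
    set (m := Rmin s (Rmin r e)).
    assert (Hm : m <= s /\ m <= r /\ m <= e).
    { unfold m. pose proof (Rmin_l s (Rmin r e)); pose proof (Rmin_r s (Rmin r e));
      pose proof (Rmin_l r e); pose proof (Rmin_r r e); lra. }
    exists m. split; [unfold m; repeat apply Rmin_glb_lt; assumption|].
    intros w Hw. destruct (Hl w) as [HU Hll]; [eapply near_weaken; [|exact Hw]; lra|].
    split; [exact HU|]. intros b Hb. destruct (classic (In b l)) as [Hin|Hout].
    + apply (Hfin b Hin Hb). eapply near_weaken; [|exact Hw]; lra.
    + assert (Hw' : near z e w) by (eapply near_weaken; [|exact Hw]; lra).
      pose proof (ev_near a _ _ _ Hw') as B1. fold (na a) in B1. apply Rabs_le_inv in B1.
      destruct (Rle_lt_dec (d b + ev b w) (c a + ev a z + 1)) as [Hle|Hgt].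
      * destruct Hout; apply Hll, Hle.
      * specialize (Hc b). nra.
Qed.

Lemma face_convex U c a : is_convex U -> is_convex (face U c a).
Proof.
  intros HU p q t [Hp Hp'] [Hq Hq'] Ht. split; [apply HU; assumption|].
  intros b Hb. change (c a + ev a (comb t p q) < c b + ev b (comb t p q)). rewrite !ev_comb.
  specialize (Hp' b Hb). specialize (Hq' b Hb).
  destruct (Req_dec t 0) as [->|Hn]; [lra|].
  assert (0 <= (1 - t) * (c b + ev b p - (c a + ev a p))) by (apply Rmult_le_pos; lra).
  assert (0 < t * (c b + ev b q - (c a + ev a q))) by (apply Rmult_lt_0_compat; lra). lra.
Qed.

(** * Smoothness and coinciding minima *)

Definition represents (U : region) (c : mono -> R) (g : pt -> R) : Prop :=
  forall z, U z -> (exists a, g z = c a + ev a z) /\ forall a, g z <= c a + ev a z.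

Lemma locally_affine_differentiable g z r k a :
  0 < r -> (forall w, near z r w -> g w = k + ev a w) -> differentiable_at g z.
Proof.
  intros Hr Hg. exists (IZR (fst a)), (IZR (snd a)). intros eps He.
  exists r. split; [exact Hr|]. intros h1 h2 Hh.
  rewrite (Hg z (near_refl z r Hr)), (Hg (fst z + h1, snd z + h2)).
  - unfold ev; simpl. replace (_ - _) with 0 by ring. rewrite Rabs_R0.
    apply Rmult_le_pos; [lra | apply sqrt_pos].
  - apply near_dist2. unfold dist2; simpl.
    replace (fst z - (fst z + h1)) with (- h1) by ring.
    replace (snd z - (snd z + h2)) with (- h2) by ring.
    replace (- h1 * (- h1 * 1) + - h2 * (- h2 * 1)) with (h1 ^ 2 + h2 ^ 2) by ring. apply Hh.
Qed.

(** The difference of [g] and the affine function has a local maximum at [z], so its derivative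
    vanishes; steps of length [t] in the four axis directions give the inequalities. *)
Lemma touching_slope g z r k a A B :
  0 < r -> (forall w, near z r w -> g w <= k + ev a w) -> g z = k + ev a z ->
  (forall eps, 0 < eps -> exists delta, 0 < delta /\ forall h1 h2,
      0 < sqrt (h1 ^ 2 + h2 ^ 2) < delta ->
      Rabs (g (fst z + h1, snd z + h2) - g z - A * h1 - B * h2)
        <= eps * sqrt (h1 ^ 2 + h2 ^ 2)) ->
  A = IZR (fst a) /\ B = IZR (snd a).
Proof.
  intros Hr Hle Heq Hd.
  assert (Hsq : forall t, sqrt (t ^ 2 + 0 ^ 2) = Rabs t /\ sqrt (0 ^ 2 + t ^ 2) = Rabs t).
  { intros t. replace (t ^ 2 + 0 ^ 2) with (Rsqr t) by (unfold Rsqr; ring).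
    replace (0 ^ 2 + t ^ 2) with (Rsqr t) by (unfold Rsqr; ring).
    rewrite sqrt_Rsqr_abs; auto. }
  assert (Hzero : forall x, (forall eps, 0 < eps -> - eps <= x <= eps) -> x = 0).
  { intros x Hx. destruct (Rtotal_order x 0) as [H|[H|H]]; [|exact H|].
    - destruct (Hx (- x / 2)); lra.
    - destruct (Hx (x / 2)); lra. }
  assert (Hside : forall eps, 0 < eps ->
     (- eps <= A - IZR (fst a) <= eps) /\ (- eps <= B - IZR (snd a) <= eps)).
  { intros eps He. destruct (Hd eps He) as [de [Hde H]].
    set (t := Rmin r de / 2).
    assert (Ht : 0 < t /\ t < r /\ t < de).
    { unfold t. assert (0 < Rmin r de) by (apply Rmin_glb_lt; assumption).
      pose proof (Rmin_l r de); pose proof (Rmin_r r de); lra. }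
    assert (Hp : Rabs t = t) by (apply Rabs_right; lra).
    assert (Hm : Rabs (- t) = t) by (rewrite Rabs_Ropp; exact Hp).
    assert (G : forall h1 h2, Rabs h1 < r -> Rabs h2 < r -> sqrt (h1 ^ 2 + h2 ^ 2) = t ->
              - (eps * t) <= (IZR (fst a) - A) * h1 + (IZR (snd a) - B) * h2).
    { intros h1 h2 H1 H2 Hs. specialize (H h1 h2). rewrite Hs in H.
      specialize (H ltac:(lra)). apply Rabs_le_inv in H.
      assert (Hw : near z r (fst z + h1, snd z + h2)).
      { split; simpl.
        - replace (_ - _) with h1 by ring; exact H1.
        - replace (_ - _) with h2 by ring; exact H2. }
      specialize (Hle _ Hw). rewrite Heq in H. unfold ev in *; simpl in Hle. lra. }
    assert (R0 : Rabs 0 < r) by (rewrite Rabs_R0; exact Hr).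
    pose proof (G t 0 ltac:(lra) R0 ltac:(rewrite (proj1 (Hsq t)); exact Hp)) as G1.
    pose proof (G (- t) 0 ltac:(lra) R0 ltac:(rewrite (proj1 (Hsq (- t))); exact Hm)) as G2.
    pose proof (G 0 t R0 ltac:(lra) ltac:(rewrite (proj2 (Hsq t)); exact Hp)) as G3.
    pose proof (G 0 (- t) R0 ltac:(lra) ltac:(rewrite (proj2 (Hsq (- t))); exact Hm)) as G4.
    assert (0 < t) as Ht0 by lra.
    repeat split; apply (Rmult_le_reg_r t); lra. }
  split; apply Rminus_diag_uniq, Hzero; intros eps He; apply (Hside eps He).
Qed.

Lemma two_minima_not_differentiable U c g z a b :
  is_open U -> represents U c g -> U z -> a <> b ->
  g z = c a + ev a z -> g z = c b + ev b z -> ~ differentiable_at g z.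
Proof.
  intros Ho Hg Hz Hab Ha Hb [A [B HD]]. rewrite open_near in Ho. destruct (Ho z Hz) as [r [Hr Hball]].
  destruct (touching_slope g z r (c a) a A B Hr) as [E1 E2]; [|exact Ha | exact HD|].
  { intros w Hw. apply Hg, Hball, Hw. }
  destruct (touching_slope g z r (c b) b A B Hr) as [F1 F2]; [|exact Hb | exact HD|].
  { intros w Hw. apply Hg, Hball, Hw. }
  apply Hab. rewrite E1 in F1. rewrite E2 in F2. apply eq_IZR in F1, F2.
  destruct a, b; simpl in *; congruence.
Qed.

Lemma face_differentiable U d c g a z :
  is_support U d -> is_open U -> (forall b, d b <= c b) -> represents U c g ->
  face U c a z -> differentiable_at g z.
Proof.
  intros Hd Ho Hc Hg Hz.
  pose proof (face_open U d c a Hd Ho Hc) as Hop. rewrite open_near in Hop.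
  destruct (Hop z Hz) as [r [Hr Hball]].
  apply (locally_affine_differentiable g z r (c a) a Hr). intros w Hw.
  destruct (Hball w Hw) as [HU Hmin]. destruct (Hg w HU) as [[b Hb] Hle].
  destruct (mono_eq_dec b a) as [->|E]; [exact Hb|].
  specialize (Hmin b E). specialize (Hle a). lra.
Qed.

Definition two_min (c : mono -> R) (p : pt) : Prop :=
  exists a b, a <> b /\ c a + ev a p = c b + ev b p /\ forall e, c a + ev a p <= c e + ev e p.

Lemma min_value U c g z a :
  represents U c g -> U z -> (g z = c a + ev a z <-> forall e, c a + ev a z <= c e + ev e z).
Proof.
  intros Hg Hz. destruct (Hg z Hz) as [[b Hb] Hle]. split.
  - intros E e. rewrite <- E. apply Hle.
  - intros H. apply Rle_antisym; [apply Hle|]. rewrite Hb. apply H.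
Qed.

Lemma two_min_or_face U c g z :
  represents U c g -> U z -> two_min c z \/ exists a, face U c a z.
Proof.
  intros Hg Hz. destruct (classic (two_min c z)) as [|Hno]; [auto|]. right.
  destruct (Hg z Hz) as [[a Ha] Hle]. exists a. split; [exact Hz|].
  intros b Hb. rewrite <- Ha. destruct (Rlt_le_dec (g z) (c b + ev b z)) as [|Hge]; [assumption|].
  destruct Hno. exists a, b. split; [congruence|]. specialize (Hle b) as Hle'.
  split; [lra|]. rewrite <- Ha. exact Hle.
Qed.

Lemma curve_two_min U d c g z :
  is_support U d -> is_open U -> (forall b, d b <= c b) -> represents U c g -> U z ->
  (~ differentiable_at g z <-> two_min c z).
Proof.
  intros Hd Ho Hc Hg Hz. split.
  - intros Hnd. destruct (two_min_or_face U c g z Hg Hz) as [|[a Ha]]; [assumption|].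
    destruct Hnd. eapply face_differentiable; eassumption.
  - intros [a [b [Hab [E Hmin]]]].
    apply (two_minima_not_differentiable U c g z a b Ho Hg Hz Hab);
    apply (min_value U c g z _ Hg Hz); [|rewrite <- E]; exact Hmin.
Qed.

(** * The operator G_P *)

Lemma tropical_series_exists Om d c :
  is_support (r2_interior Om) d -> (forall a, d a <= c a) ->
  exists g, tropical_series Om g /\ represents (r2_interior Om) c g.
Proof.
  intros Hd Hc. set (U := r2_interior Om) in *.
  (* The value 0 off the interior settles the boundary condition. *)
  set (g := fun z => epsilon (inhabits 0) (fun v =>
     (U z -> exists a, v = c a + ev a z /\ forall b, v <= c b + ev b z) /\ (~ U z -> v = 0))).
  assert (Hg : forall z, (U z -> exists a, g z = c a + ev a z /\ forall b, g z <= c b + ev b z) /\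
                         (~ U z -> g z = 0)).
  { intros z. unfold g. apply epsilon_spec. destruct (classic (U z)) as [Hz|Hz].
    - destruct (min_attained U d c z Hd (interior_open Om) Hc Hz) as [a Ha].
      exists (c a + ev a z). split; [intros _; exists a; split; [reflexivity | exact Ha] | contradiction].
    - exists 0. split; [contradiction | reflexivity]. }
  assert (Hr : represents U c g).
  { intros z Hz. destruct (proj1 (Hg z) Hz) as [a [E H]]. split; [exists a; exact E | exact H]. }
  exists g. split; [|exact Hr]. split; [|split].
  - intros p _. destruct (classic (U p)) as [Hp|Hp].
    + destruct (proj1 (Hg p) Hp) as [a [-> _]]. specialize (Hc a).
      pose proof (support_ge U d a p Hd Hp). lra.
    + rewrite (proj2 (Hg p) Hp). lra.
  - intros p [_ Hp]. apply Hg, Hp.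
  - exists (fun i j => Some (c (i, j))). intros p Hp. destruct (Hr p Hp) as [[[i j] Ha] Hle].
    split.
    + exists i, j, (c (i, j)). split; [reflexivity|]. rewrite Ha. unfold ev; simpl; ring.
    + intros i' j' r E. injection E as <-. specialize (Hle (i', j')). unfold ev in Hle; simpl in Hle. lra.
Qed.

(** The supremum of [g - ev a] is the least admissible coefficient of [a]. It is finite for every
    [a], so infinite coefficients disappear from the representation, and [g >= 0] gives [c >= d]. *)
Lemma canonical_coefficients U d M g :
  is_support U d -> (forall w, U w -> Rabs (fst w) <= M /\ Rabs (snd w) <= M) ->
  (exists w, U w) -> (forall w, U w -> 0 <= g w) ->
  (forall z, U z -> exists a r, g z = r + ev a z /\ forall w, U w -> g w <= r + ev a w) ->
  exists c, (forall a, d a <= c a) /\ represents U c g /\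
    forall a r, (forall w, U w -> g w <= r + ev a w) -> c a <= r.
Proof.
  intros Hd HM [w0 Hw0] Hpos Hsup.
  assert (Hev : forall a w, U w -> Rabs (ev a w) <= (Rabs (IZR (fst a)) + Rabs (IZR (snd a))) * M).
  { intros a w Hw. destruct (HM w Hw). unfold ev. eapply Rle_trans; [apply Rabs_triang|].
    rewrite !Rabs_mult. pose proof (Rabs_pos (IZR (fst a))); pose proof (Rabs_pos (IZR (snd a))). nra. }
  assert (Hb : forall a, bound (fun x => exists w, U w /\ x = g w - ev a w)).
  { intros a. destruct (Hsup w0 Hw0) as [b [r [_ Hr]]].
    eexists. intros x [w [Hw ->]]. specialize (Hr w Hw).
    pose proof (Hev a w Hw) as B1. pose proof (Hev b w Hw) as B2. apply Rabs_le_inv in B1, B2.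
    apply Rle_trans with (r + (Rabs (IZR (fst b)) + Rabs (IZR (snd b))) * M
       + (Rabs (IZR (fst a)) + Rabs (IZR (snd a))) * M); [lra | apply Rle_refl]. }
  assert (Hn : forall a, exists x, exists w, U w /\ x = g w - ev a w) by (intros a; eauto).
  set (c := fun a => proj1_sig (completeness _ (Hb a) (Hn a))).
  assert (Hc : forall a, is_lub (fun x => exists w, U w /\ x = g w - ev a w) (c a)).
  { intros a. exact (proj2_sig (completeness _ (Hb a) (Hn a))). }
  assert (Hmin : forall a r, (forall w, U w -> g w <= r + ev a w) -> c a <= r).
  { intros a r H. apply (Hc a). intros x [w [Hw ->]]. specialize (H w Hw). lra. }
  assert (Hge : forall a w, U w -> g w <= c a + ev a w).
  { intros a w Hw. assert (g w - ev a w <= c a) by (apply (Hc a); eauto). lra. }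
  exists c. split; [|split; [|exact Hmin]].
  - intros a. apply (Hd a). intros x [w [Hw ->]]. specialize (Hge a w Hw). specialize (Hpos w Hw). lra.
  - intros z Hz. split; [|intros a; apply Hge, Hz].
    destruct (Hsup z Hz) as [a [r [E Hr]]]. exists a. specialize (Hmin a r Hr).
    specialize (Hge a z Hz). lra.
Qed.

Definition bounded_by (U : region) (M : R) : Prop :=
  forall w, U w -> Rabs (fst w) <= M /\ Rabs (snd w) <= M.

Lemma tropical_coefficients Om d M g :
  is_support (r2_interior Om) d -> bounded_by (r2_interior Om) M ->
  (exists w, r2_interior Om w) -> tropical_series Om g ->
  exists c, (forall a, d a <= c a) /\ represents (r2_interior Om) c g.
Proof.
  intros Hd HM Hne [Hpos [_ [co Hco]]].
  destruct (canonical_coefficients (r2_interior Om) d M g Hd HM Hne) as [c [H1 [H2 _]]].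
  - intros w Hw. apply Hpos, interior_sub, Hw.
  - intros z Hz. destruct (Hco z Hz) as [[i [j [r [E Hv]]]] _].
    exists (i, j), r. split; [rewrite Hv; unfold ev; simpl; ring|].
    intros w Hw. destruct (Hco w Hw) as [_ H]. specialize (H i j r E). unfold ev; simpl. lra.
  - exists c; auto.
Qed.

Lemma admissible_of_two_min Om d n pts c :
  is_support (r2_interior Om) d -> (forall a, d a <= c a) ->
  (forall i, (i < n)%nat -> r2_interior Om (pts i) /\ two_min c (pts i)) ->
  exists g, admissible Om n pts zero_fun g /\ represents (r2_interior Om) c g.
Proof.
  intros Hd Hc Hp. destruct (tropical_series_exists Om d c Hd Hc) as [g [Hg Hr]].
  exists g. split; [|exact Hr]. split; [exact Hg|]. split.
  - intros q Hq. apply Hg, Hq.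
  - intros i Hi. destruct (Hp i Hi) as [HU H2]. split; [exact HU|].
    apply (curve_two_min (r2_interior Om) d c g); auto using interior_open.
Qed.

Lemma two_min_of_admissible Om d M n pts g :
  is_support (r2_interior Om) d -> bounded_by (r2_interior Om) M ->
  (exists w, r2_interior Om w) -> admissible Om n pts zero_fun g ->
  exists c, (forall a, d a <= c a) /\ represents (r2_interior Om) c g /\
    forall i, (i < n)%nat -> two_min c (pts i).
Proof.
  intros Hd HM Hne [Hg [_ Hp]].
  destruct (tropical_coefficients Om d M g Hd HM Hne Hg) as [c [Hc Hr]].
  exists c. split; [exact Hc|]. split; [exact Hr|]. intros i Hi. destruct (Hp i Hi) as [HU Hnd].
  apply (curve_two_min (r2_interior Om) d c g); auto using interior_open.
Qed.

(* The witness is the sum of the functions [min 0 (t - x i)]. *)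
Lemma univariate_corners (x : nat -> R) M n :
  exists (G : R -> R) (l : list (Z * R)) (C : R),
    (forall t, Rabs t <= M -> - C <= G t) /\
    (forall t, exists q, In q l /\ G t = snd q + IZR (fst q) * t) /\
    (forall t q, In q l -> G t <= snd q + IZR (fst q) * t) /\
    forall i, (i < n)%nat -> exists q q', In q l /\ In q' l /\ fst q <> fst q' /\
      G (x i) = snd q + IZR (fst q) * x i /\ G (x i) = snd q' + IZR (fst q') * x i.
Proof.
  induction n as [|n [G [l [C [H1 [H2 [H3 H4]]]]]]].
  - exists (fun _ => 0), [(0%Z, 0)], 0. split; [|split; [|split]].
    + intros; lra.
    + intros t. eexists; split; [left; reflexivity | simpl; ring].
    + intros t q [<-|[]]; simpl; lra.
    + intros i Hi; lia.
  (* [up] adds the affine function [t - x n], the second branch of the new summand. *)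
  - set (up := fun q : Z * R => ((fst q + 1)%Z, snd q - x n)).
    assert (Hup : forall q t, snd (up q) + IZR (fst (up q)) * t = snd q + IZR (fst q) * t + (t - x n)).
    { intros q t. unfold up; simpl. rewrite plus_IZR. ring. }
    assert (Hin : forall q, In q l -> In (up q) (l ++ map up l)).
    { intros q Hq. apply in_app_iff; right. apply in_map, Hq. }
    assert (Hin' : forall q, In q l -> In q (l ++ map up l)).
    { intros q Hq. apply in_app_iff; left. exact Hq. }
    exists (fun t => G t + Rmin 0 (t - x n)), (l ++ map up l), (C + Rabs (x n) + M).
    split; [|split; [|split]].
    + intros t Ht. specialize (H1 t Ht). apply Rabs_le_inv in Ht.
      pose proof (Rle_abs (x n)). pose proof (Rabs_pos (x n)).
      assert (- (Rabs (x n) + M) <= Rmin 0 (t - x n)) by (apply Rmin_glb; lra). lra.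
    + intros t. destruct (H2 t) as [q [Hq E]]. destruct (Rle_lt_dec 0 (t - x n)).
      * exists q. split; [auto|]. rewrite Rmin_left by assumption. lra.
      * exists (up q). split; [auto|]. rewrite Hup, Rmin_right by lra. lra.
    + intros t q Hq. apply in_app_iff in Hq as [Hq|Hq].
      * specialize (H3 t q Hq). pose proof (Rmin_l 0 (t - x n)). lra.
      * apply in_map_iff in Hq as [q' [<- Hq]]. rewrite Hup. specialize (H3 t q' Hq).
        pose proof (Rmin_r 0 (t - x n)). lra.
    + intros i Hi. destruct (Nat.eq_dec i n) as [->|Hne].
      * destruct (H2 (x n)) as [q [Hq E]]. exists q, (up q).
        split; [auto|]. split; [auto|]. split; [unfold up; simpl; lia|].
        rewrite Hup, Rminus_diag, Rmin_left by lra. lra.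
      (* At an old corner both monomials take the same branch of the new summand, so their slopes
         still differ. *)
      * destruct (H4 i) as [q [q' [Q1 [Q2 [Q3 [Q4 Q5]]]]]]; [lia|].
        destruct (Rle_lt_dec 0 (x i - x n)).
        -- exists q, q'. rewrite Rmin_left by assumption. repeat split; auto; lra.
        -- exists (up q), (up q'). rewrite !Hup, Rmin_right by lra.
           repeat split; auto; [unfold up; simpl; lia | lra | lra].
Qed.

(** A series in the abscissa alone, with vertical corner lines through the points, is raised by [C]
    to be nonnegative. *)
Lemma admissible_exists Om d M n pts :
  is_support (r2_interior Om) d -> bounded_by (r2_interior Om) M ->
  (exists w, r2_interior Om w) -> (forall i, (i < n)%nat -> r2_interior Om (pts i)) ->
  exists g, admissible Om n pts zero_fun g.
Proof.
  intros Hd HM Hne Hp.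
  destruct (univariate_corners (fun i => fst (pts i)) M n) as [G [l [C [H1 [H2 [H3 H4]]]]]].
  assert (Hev : forall j w, ev (j, 0%Z) w = IZR j * fst w) by (intros; unfold ev; simpl; ring).
  destruct (canonical_coefficients (r2_interior Om) d M (fun w => C + G (fst w)) Hd HM Hne)
    as [c [Hc [Hr Hleast]]].
  - intros w Hw. destruct (HM w Hw) as [B _]. specialize (H1 _ B). lra.
  - intros z Hz. destruct (H2 (fst z)) as [q [Hq E]].
    exists (fst q, 0%Z), (C + snd q). rewrite Hev, E. split; [ring|].
    intros w Hw. rewrite Hev. specialize (H3 (fst w) q Hq). lra.
  - destruct (admissible_of_two_min Om d n pts c Hd Hc) as [g [Hg _]]; [|exists g; exact Hg].
    intros i Hi. split; [auto|].
    destruct (H4 i Hi) as [q [q' [Q1 [Q2 [Q3 [Q4 Q5]]]]]].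
    (* Passing to the least coefficients keeps a monomial minimal wherever it already attained the
       value. *)
    assert (Hatt : forall q, In q l -> G (fst (pts i)) = snd q + IZR (fst q) * fst (pts i) ->
       C + G (fst (pts i)) = c (fst q, 0%Z) + ev (fst q, 0%Z) (pts i)).
    { intros p Hpl E. destruct (Hr (pts i) (Hp i Hi)) as [_ Hle].
      apply Rle_antisym; [apply Hle|]. rewrite Hev, E.
      assert (c (fst p, 0%Z) <= C + snd p); [|lra]. apply Hleast. intros w Hw. rewrite Hev.
      specialize (H3 (fst w) p Hpl). lra. }
    exists (fst q, 0%Z), (fst q', 0%Z). split; [congruence|].
    rewrite <- (Hatt q Q1 Q4), <- (Hatt q' Q2 Q5). split; [reflexivity|]. apply Hr; auto.
Qed.

Definition least_admissible (Om : region) (n : nat) (pts : nat -> pt) (f : pt -> R) : Prop :=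
  forall g, admissible Om n pts zero_fun g -> forall z, r2_interior Om z -> f z <= g z.

Lemma GP_coefficients Om d M n pts :
  is_support (r2_interior Om) d -> bounded_by (r2_interior Om) M ->
  (exists w, r2_interior Om w) -> (forall i, (i < n)%nat -> r2_interior Om (pts i)) ->
  exists c, (forall a, d a <= c a) /\ (forall i, (i < n)%nat -> two_min c (pts i)) /\
    forall f, represents (r2_interior Om) c f -> least_admissible Om n pts f.
Proof.
  intros Hd HM Hne Hp. set (U := r2_interior Om) in *.
  (* Signs are reversed because [completeness] yields suprema, whereas an infimum of coefficients is
     wanted. *)
  set (E := fun a x => exists r g, x = - r /\ admissible Om n pts zero_fun g /\
                 forall w, U w -> g w <= r + ev a w).
  assert (Hpos : forall g w, admissible Om n pts zero_fun g -> U w -> 0 <= g w).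
  { intros g w [[H _] _] Hw. apply H, interior_sub, Hw. }
  assert (Hlow : forall a r g, admissible Om n pts zero_fun g ->
            (forall w, U w -> g w <= r + ev a w) -> d a <= r).
  { intros a r g Hg H. apply (Hd a). intros x [w [Hw ->]].
    specialize (H w Hw). specialize (Hpos g w Hg Hw). lra. }
  assert (Hb : forall a, bound (E a)).
  { intros a. exists (- d a). intros x [r [g [-> [Hg H]]]].
    specialize (Hlow a r g Hg H). lra. }
  assert (Hn : forall a, exists x, E a x).
  { intros a. destruct (admissible_exists Om d M n pts Hd HM Hne Hp) as [g Hg].
    destruct (two_min_of_admissible Om d M n pts g Hd HM Hne Hg) as [c [Hc [Hr _]]].
    exists (- c a), (c a), g. split; [reflexivity|]. split; [exact Hg|]. intros w Hw. apply Hr, Hw. }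
  set (c := fun a => - proj1_sig (completeness _ (Hb a) (Hn a))).
  assert (Hc : forall a, is_lub (E a) (- c a)).
  { intros a. unfold c. rewrite Ropp_involutive. exact (proj2_sig (completeness _ (Hb a) (Hn a))). }
  assert (Hcle : forall a r g, admissible Om n pts zero_fun g ->
            (forall w, U w -> g w <= r + ev a w) -> c a <= r).
  { intros a r g Hg H. assert (- r <= - c a); [|lra]. apply (Hc a). exists r, g; auto. }
  assert (Happ : forall a e, 0 < e -> exists r g, r < c a + e /\ admissible Om n pts zero_fun g /\
            forall w, U w -> g w <= r + ev a w).
  { intros a e He. apply NNPP; intros Hno. assert (- c a <= - (c a + e)); [|lra].
    apply (Hc a). intros x [r [g [-> [Hg H]]]].
    destruct (Rlt_le_dec r (c a + e)); [|lra]. destruct Hno; exists r, g; auto. }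
  assert (Hdc : forall a, d a <= c a).
  { intros a. destruct (Rle_lt_dec (d a) (c a)) as [|H]; [assumption|]. exfalso.
    destruct (Happ a (d a - c a)) as [r [g [Hr [Hg H']]]]; [lra|].
    specialize (Hlow a r g Hg H'). lra. }
  exists c. split; [exact Hdc|]. split.
  - intros i Hi.
    destruct (tropical_series_exists Om d c Hd Hdc) as [f [_ Hf]]. fold U in Hf.
    destruct (two_min_or_face U c f (pts i) Hf (Hp i Hi)) as [|[a Ha]]; [assumption|]. exfalso.
    destruct Ha as [HUi Ha].
    (* After [c a] is raised by 1 the minimum is still attained; its excess over the old minimum is
       a uniform gap. *)
    assert (exists e, 0 < e /\ forall b, b <> a -> c a + ev a (pts i) + e <= c b + ev b (pts i))
      as [e [He Hgap]].
    { destruct (min_attained U d (fun b => if mono_eq_dec b a then c a + 1 else c b) (pts i) Hd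
        (interior_open Om)) as [b0 Hb0]; [|exact HUi|].
      - intros b; destruct (mono_eq_dec b a) as [->|]; [specialize (Hdc a); lra | apply Hdc].
      - set (v := (if mono_eq_dec b0 a then c a + 1 else c b0) + ev b0 (pts i)) in Hb0.
        exists (v - (c a + ev a (pts i))). split.
        + unfold v. destruct (mono_eq_dec b0 a) as [->|Hne0]; [lra|].
          specialize (Ha b0 Hne0). lra.
        + intros b Hba. specialize (Hb0 b). destruct (mono_eq_dec b a); [contradiction | lra]. }
    (* At the point, [g] is less than the minimum plus [e] because of [a], yet a second minimal
       monomial [b], with coefficient at least [c b], forces at least the minimum plus [e]. *)
    destruct (Happ a e He) as [r [g [Hr [Hg Hga]]]].
    destruct (two_min_of_admissible Om d M n pts g Hd HM Hne Hg) as [cg [Hcg [Hrg Htg]]]. fold U in Hrg.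
    destruct (Htg i Hi) as [a1 [a2 [Ha12 [E12 Hmin]]]].
    assert (exists b, b <> a /\ g (pts i) = cg b + ev b (pts i)) as [b [Hba Eb]].
    { assert (Eg : g (pts i) = cg a1 + ev a1 (pts i)) by (apply (min_value U cg g _ _ Hrg HUi), Hmin).
      destruct (mono_eq_dec a1 a) as [->|]; [exists a2 | exists a1]; split; try congruence. }
    assert (c b <= cg b).
    { apply (Hcle b _ g Hg). intros w Hw. apply Hrg, Hw. }
    specialize (Hgap b Hba). specialize (Hga (pts i) HUi). lra.
  - intros f Hf g Hg z Hz.
    destruct (two_min_of_admissible Om d M n pts g Hd HM Hne Hg) as [cg [Hcg [Hrg _]]].
    destruct (Hrg z Hz) as [[a Ea] _]. destruct (Hf z Hz) as [_ Hle]. specialize (Hle a).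
    assert (c a <= cg a); [|lra]. apply (Hcle a _ g Hg). intros w Hw. apply Hrg, Hw.
Qed.

Lemma GP_exists Om d M n pts :
  is_support (r2_interior Om) d -> bounded_by (r2_interior Om) M ->
  (exists w, r2_interior Om w) -> (forall i, (i < n)%nat -> r2_interior Om (pts i)) ->
  exists c f, is_GP Om n pts zero_fun f /\
    (forall a, d a <= c a) /\ (forall i, (i < n)%nat -> two_min c (pts i)) /\
    forall h, is_GP Om n pts zero_fun h ->
      represents (r2_interior Om) c h /\ least_admissible Om n pts h.
Proof.
  intros Hd HM Hne Hp.
  destruct (GP_coefficients Om d M n pts Hd HM Hne Hp) as [c [Hc [H2 Hleast]]].
  destruct (admissible_of_two_min Om d n pts c Hd Hc) as [f [Hf Hr]]; [auto|].
  exists c, f.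
  (* Points of [Om] off the interior are boundary points, where every series vanishes. *)
  assert (Hle : forall g, admissible Om n pts zero_fun g -> forall q, Om q -> f q <= g q).
  { intros g Hg q Hq. destruct (classic (r2_interior Om q)) as [Hi|Hi].
    - apply (Hleast f Hr g Hg q Hi).
    - assert (Hbd : r2_boundary Om q) by (split; [apply closure_sub, Hq | exact Hi]).
      destruct Hf as [[_ [Hf0 _]] _], Hg as [[_ [Hg0 _]] _]. rewrite Hf0, Hg0 by exact Hbd. lra. }
  split; [|split; [exact Hc | split; [exact H2|]]].
  - intros q Hq. split; [exists f; auto|]. intros g Hg. apply Hle; assumption.
  - intros h Hh.
    assert (E : forall q, r2_interior Om q -> h q = f q).
    { intros q Hq. apply interior_sub in Hq. destruct (Hh q Hq) as [[g [Hg Eg]] Hmin].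
      apply Rle_antisym; [apply Hmin, Hf|]. rewrite <- Eg. apply Hle; assumption. }
    assert (Hrh : represents (r2_interior Om) c h).
    { intros z Hz. rewrite (E z Hz). apply Hr, Hz. }
    split; [exact Hrh | apply Hleast, Hrh].
Qed.

(** * Counting the inner faces *)

(* Whenever some [M i] meets [S] in exactly one point, that point is discarded; each index
   discards at most one point. *)
Lemma no_singleton_trace {A} (M : nat -> A -> Prop) (I : list nat) :
  forall S : list A, NoDup S -> (length I < length S)%nat ->
  exists S', incl S' S /\ (exists x, In x S') /\
    forall i, In i I -> (forall x, In x S' -> ~ M i x) \/
      exists x y, x <> y /\ In x S' /\ In y S' /\ M i x /\ M i y.
Proof.
  remember (length I) as k eqn:Hk. revert I Hk.
  induction k as [|k IH]; intros I Hk S HS Hlen.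
  - destruct I; [|discriminate]. exists S. split; [apply incl_refl|]. split.
    + destruct S as [|x S]; [simpl in Hlen; lia | exists x; left; reflexivity].
    + intros i [].
  - destruct (classic (exists i, In i I /\ exists x, In x S /\ M i x /\
        forall y, In y S -> M i y -> y = x)) as [[i [Hi [x [Hx [Hix Huniq]]]]]|Hno].
    + destruct (in_split _ _ Hi) as [I1 [I2 ->]]. destruct (in_split _ _ Hx) as [S1 [S2 ->]].
      destruct (IH (I1 ++ I2)) with (S := S1 ++ S2) as [S' [Hincl [Hne HS']]].
      * rewrite length_app in *; simpl in Hk; lia.
      * eapply NoDup_remove_1; eassumption.
      * rewrite length_app in *; simpl in Hlen; lia.
      * exists S'. split; [|split; [exact Hne|]].
        -- intros y Hy. apply Hincl, in_app_iff in Hy. apply in_app_iff; simpl; tauto.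
        -- intros j Hj. apply in_app_iff in Hj as [Hj|[<-|Hj]].
           ++ apply HS', in_app_iff; auto.
           ++ left. intros y Hy Hiy. apply Hincl in Hy.
              assert (y = x) as ->.
              { apply Huniq; [|exact Hiy]. apply in_app_iff in Hy. apply in_app_iff; simpl; tauto. }
              apply (NoDup_remove_2 _ _ _ HS Hy).
           ++ apply HS', in_app_iff; auto.
    + exists S. split; [apply incl_refl|]. split.
      * destruct S as [|x S]; [simpl in Hlen; lia | exists x; left; reflexivity].
      * intros i Hi. destruct (classic (exists x, In x S /\ M i x)) as [[x [Hx Hix]]|Hn].
        -- right. apply NNPP; intros Hno2. apply Hno. exists i. split; [exact Hi|].
           exists x. split; [exact Hx|]. split; [exact Hix|]. intros y Hy Hiy.
           apply NNPP; intros Hxy. apply Hno2. exists x, y. repeat split; auto.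
        -- left. intros x Hx Hix. apply Hn; eauto.
Qed.

Lemma finite_of_bounded {A} (P : A -> Prop) n :
  (forall l, NoDup l -> (forall x, In x l -> P x) -> (length l <= n)%nat) ->
  exists l, NoDup l /\ (forall x, In x l <-> P x) /\ (length l <= n)%nat.
Proof.
  intros H. apply NNPP; intros Hno.
  assert (forall k, exists l, NoDup l /\ (forall x, In x l -> P x) /\ length l = k) as G.
  { induction k as [|k [l [H1 [H2 H3]]]].
    - exists nil. split; [constructor|]. split; [intros x [] | reflexivity].
    - assert (exists x, P x /\ ~ In x l) as [x [Hx Hxl]].
      { apply NNPP; intros Hno2. apply Hno. exists l. split; [exact H1|]. split; [|auto].
        intros x; split; [auto|]. intros Hx. apply NNPP; eauto. }
      exists (x :: l). split; [constructor; assumption|]. split; [|simpl; congruence].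
      intros y [<-|Hy]; auto. }
  destruct (G (S n)) as [l [H1 [H2 H3]]]. specialize (H l H1 H2). lia.
Qed.

Definition attained (U : region) (c : mono -> R) (h : pt -> R) (a : mono) : Prop :=
  exists z, U z /\ h z = c a + ev a z.

(** All coefficients on [S] are lowered by one small [e]. At each point either the minimal monomials
    are untouched and stay below the lowered ones, or two elements of [S] sink together and share
    the new minimum. The result is admissible, yet smaller where an element of [S] attains [h]. *)
Lemma lowerable_false Om d n pts c h S :
  is_support (r2_interior Om) d -> (forall a, d a <= c a) ->
  (forall i, (i < n)%nat -> r2_interior Om (pts i) /\ two_min c (pts i)) ->
  represents (r2_interior Om) c h -> least_admissible Om n pts h ->
  (exists x, In x S) ->
  (forall x, In x S -> d x < c x /\ attained (r2_interior Om) c h x) ->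
  (forall i, (i < n)%nat -> (forall x, In x S -> h (pts i) <> c x + ev x (pts i)) \/
     exists x y, x <> y /\ In x S /\ In y S /\
       h (pts i) = c x + ev x (pts i) /\ h (pts i) = c y + ev y (pts i)) ->
  False.
Proof.
  intros Hd Hc Hp Hr Hmin [s Hs] HS Hpt.
  (* For nonminimal pairs half the gap is taken, so that a lowered monomial stays above the
     minimum. *)
  destruct (finite_radius (list_prod (seq 0 n) S) (fun ix e =>
      e <= c (snd ix) - d (snd ix) /\
      (h (pts (fst ix)) <> c (snd ix) + ev (snd ix) (pts (fst ix)) ->
       h (pts (fst ix)) < c (snd ix) + ev (snd ix) (pts (fst ix)) - e))) as [e1 [He1 H1]].
  { intros [i x] Hix. apply in_prod_iff in Hix as [Hi Hx]. apply in_seq in Hi. simpl.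
    destruct (HS x Hx) as [Hdx _]. destruct (Hp i ltac:(lia)) as [HU _].
    destruct (Hr _ HU) as [_ Hle]. specialize (Hle x).
    set (g := c x + ev x (pts i) - h (pts i)) in *.
    destruct (Req_dec (h (pts i)) (c x + ev x (pts i))) as [E|E].
    - exists (c x - d x). split; [lra|]. split; [lra | contradiction].
    - exists (Rmin (c x - d x) (g / 2)). pose proof (Rmin_l (c x - d x) (g / 2)).
      pose proof (Rmin_r (c x - d x) (g / 2)). unfold g in *.
      split; [apply Rmin_glb_lt; lra|]. split; [lra|]. intros _. lra. }
  { intros ix r r' Hr' [Q1 Q2]. split; [lra|]. intros E. specialize (Q2 E). lra. }
  destruct (finite_radius S (fun x e => e <= c x - d x)) as [e2 [He2 H2]].
  { intros x Hx. exists (c x - d x). destruct (HS x Hx); lra. }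
  { intros; lra. }
  set (e := Rmin e1 e2).
  assert (He : 0 < e /\ e <= e1 /\ e <= e2).
  { unfold e. split; [apply Rmin_glb_lt; assumption|]. split; [apply Rmin_l | apply Rmin_r]. }
  set (c' := fun a => if excluded_middle_informative (In a S) then c a - e else c a).
  assert (Hin : forall a, In a S -> c' a = c a - e).
  { intros a Ha; unfold c'. destruct (excluded_middle_informative _); [reflexivity | contradiction]. }
  assert (Hout : forall a, ~ In a S -> c' a = c a).
  { intros a Ha; unfold c'. destruct (excluded_middle_informative _); [contradiction | reflexivity]. }
  assert (Hc' : forall a, d a <= c' a).
  { intros a. destruct (classic (In a S)) as [Ha|Ha].
    - rewrite (Hin a Ha). specialize (H2 a Ha). lra.
    - rewrite (Hout a Ha). apply Hc. }
  destruct (admissible_of_two_min Om d n pts c' Hd Hc') as [g [Hg Hrg]].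
  { intros i Hi. destruct (Hp i Hi) as [HU [a [b [Hab [E Hmin']]]]]. split; [exact HU|].
    destruct (Hr _ HU) as [_ Hle].
    assert (Ea : h (pts i) = c a + ev a (pts i)) by (apply (min_value _ c h _ _ Hr HU), Hmin').
    destruct (Hpt i Hi) as [Hnone|[x [y [Hxy [Hx [Hy [Ex Ey]]]]]]].
    - exists a, b. split; [exact Hab|].
      assert (Ha : ~ In a S) by (intros Ha; apply (Hnone a Ha), Ea).
      assert (Hb : ~ In b S) by (intros Hb; apply (Hnone b Hb); congruence).
      rewrite (Hout a Ha), (Hout b Hb). split; [exact E|]. intros f. rewrite <- Ea.
      destruct (classic (In f S)) as [Hf|Hf].
      + rewrite (Hin f Hf). destruct (H1 (i, f)) as [_ Q].
        { apply in_prod; [apply in_seq; lia | exact Hf]. }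
        simpl in Q. specialize (Q (Hnone f Hf)). lra.
      + rewrite (Hout f Hf). apply Hle.
    - exists x, y. split; [exact Hxy|]. rewrite (Hin x Hx), (Hin y Hy). split; [lra|].
      intros f. specialize (Hle f). destruct (classic (In f S)) as [Hf|Hf].
      + rewrite (Hin f Hf). lra.
      + rewrite (Hout f Hf). lra. }
  destruct (HS s Hs) as [_ [z [Hz Ez]]].
  specialize (Hmin g Hg z Hz). destruct (Hrg z Hz) as [_ Hle]. specialize (Hle s).
  rewrite (Hin s Hs) in Hle. lra.
Qed.

Lemma attained_bound Om d n pts c h l :
  is_support (r2_interior Om) d -> (forall a, d a <= c a) ->
  (forall i, (i < n)%nat -> r2_interior Om (pts i) /\ two_min c (pts i)) ->
  represents (r2_interior Om) c h -> least_admissible Om n pts h ->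
  NoDup l -> (forall x, In x l -> d x < c x /\ attained (r2_interior Om) c h x) ->
  (length l <= n)%nat.
Proof.
  intros Hd Hc Hp Hr Hmin Hl HP. destruct (Nat.le_gt_cases (length l) n) as [|Hlen]; [assumption|].
  exfalso.
  destruct (no_singleton_trace (fun i x => h (pts i) = c x + ev x (pts i)) (seq 0 n) l Hl)
    as [S [Hincl [Hne HS]]].
  { rewrite length_seq. exact Hlen. }
  apply (lowerable_false Om d n pts c h S); auto.
  intros i Hi. apply (HS i), in_seq. lia.
Qed.

Lemma nonspecial_lower_bound d n pts c K :
  ~ special d n pts -> (forall i, (i < n)%nat -> two_min c (pts i)) ->
  (forall i a, (i < n)%nat -> (forall e, c a + ev a (pts i) <= c e + ev e (pts i)) ->
     c a <> d a -> In a K) ->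
  (n <= length K)%nat.
Proof.
  intros Hns H2 HK. destruct (Nat.le_gt_cases n (length K)) as [|Hlen]; [assumption|].
  destruct Hns. exists c, K. split; [exact Hlen|]. intros i Hi.
  destruct (H2 i Hi) as [a [b [Hab [E Hmin]]]]. exists a, b. split; [exact Hab|].
  split; [exact E|]. split; [apply HK with i; auto|].
  apply HK with i; auto. rewrite <- E. exact Hmin.
Qed.

Lemma attained_face Om d n pts c h a :
  is_support (r2_interior Om) d -> (forall a, d a <= c a) ->
  (forall i, (i < n)%nat -> r2_interior Om (pts i) /\ two_min c (pts i)) ->
  represents (r2_interior Om) c h -> least_admissible Om n pts h ->
  ~ special d n pts -> d a < c a -> attained (r2_interior Om) c h a ->
  exists z, face (r2_interior Om) c a z.
Proof.
  intros Hd Hc Hp Hr Hmin Hns Hda Hatt. apply NNPP; intros Hno.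
  set (U := r2_interior Om) in *.
  (* without a face, raising the coefficient does not change the minimum *)
  set (c' := fun b => if mono_eq_dec b a then c a + 1 else c b).
  assert (Hca : c' a = c a + 1) by (unfold c'; destruct (mono_eq_dec a a); [reflexivity | congruence]).
  assert (Hcb : forall b, b <> a -> c' b = c b).
  { intros b Hb; unfold c'; destruct (mono_eq_dec b a); [contradiction | reflexivity]. }
  assert (Hcc : forall b, c b <= c' b).
  { intros b. destruct (mono_eq_dec b a) as [->|Hb]; [rewrite Hca | rewrite (Hcb b Hb)]; lra. }
  assert (Hr' : represents U c' h).
  { intros z Hz. destruct (Hr z Hz) as [[b Hb] Hle]. split.
    - destruct (mono_eq_dec b a) as [->|Hba]; [|exists b; rewrite (Hcb b Hba); exact Hb].
      apply NNPP; intros Hno2. apply Hno. exists z. split; [exact Hz|]. intros b Hba.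
      rewrite <- Hb. destruct (Rlt_le_dec (h z) (c b + ev b z)) as [|Hge]; [assumption|].
      destruct Hno2. exists b. rewrite (Hcb b Hba). specialize (Hle b). lra.
    - intros f. specialize (Hle f). specialize (Hcc f). lra. }
  destruct (finite_of_bounded (fun x => d x < c x /\ attained U c h x) n) as [K [HK1 [HK2 HK3]]].
  { intros l Hl HP. apply (attained_bound Om d n pts c h l); auto. }
  assert (HaK : In a K) by (apply HK2; auto).
  destruct (in_split _ _ HaK) as [K1 [K2 ->]].
  (* Under [c'] the monomial [a] is minimal at no point, so [K] without [a] meets the lower bound
     too, although it has at most [n - 1] elements. *)
  assert (n <= length (K1 ++ K2))%nat.
  { apply (nonspecial_lower_bound d n pts c'); [exact Hns | |].
    - intros i Hi. destruct (Hp i Hi) as [HU H2].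
      pose proof (interior_open Om) as Hop.
      apply (curve_two_min U d c' h); auto.
      + intros b. specialize (Hc b). specialize (Hcc b). lra.
      + apply (curve_two_min U d c h); auto.
    - intros i b Hi Hmb Hne. destruct (Hp i Hi) as [HU _].
      apply (min_value U c' h _ _ Hr' HU) in Hmb.
      assert (Hba : b <> a).
      { intros ->. rewrite Hca in Hmb. destruct (Hr _ HU) as [_ Hle]. specialize (Hle a). lra. }
      rewrite (Hcb b Hba) in Hne, Hmb.
      assert (Hin : In b (K1 ++ a :: K2)).
      { apply HK2. specialize (Hc b). split; [lra|]. exists (pts i); auto. }
      apply in_app_iff in Hin. apply in_app_iff. destruct Hin as [|[|]]; [auto | congruence | auto]. }
  rewrite length_app in *. simpl in HK3. lia.
Qed.

(** * Faces and the boundary *)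

(** A minimizer of [ev a] on the closure is a zero of [d a + ev a], and the growth bound excludes
    zeros of nonconstant monomials from the interior. *)
Lemma boundary_zero Om d M a :
  is_support (r2_interior Om) d -> bounded_by (r2_interior Om) M ->
  (exists w, r2_interior Om w) ->
  exists q, r2_closure (r2_interior Om) q /\ r2_boundary Om q /\ d a + ev a q = 0.
Proof.
  intros Hd HM Hne. set (U := r2_interior Om) in *.
  assert (G : forall b : mono, b <> (0, 0)%Z ->
     exists q, r2_closure U q /\ r2_boundary Om q /\ d b + ev b q = 0).
  { intros b Hb.
    destruct (linear_min U M (IZR (fst b)) (IZR (snd b)) HM Hne) as [q [Hq Hmin]].
    { destruct b as [i j]; simpl. destruct (Z.eq_dec i 0) as [->|].
      - right. intros E. apply eq_IZR in E. congruence.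
      - left. intros E. apply eq_IZR in E. congruence. }
    assert (E0 : d b + ev b q = 0).
    { apply Rle_antisym; [|apply (support_closure U d b q Hd Hq)].
      assert (d b <= - ev b q); [|lra]. apply (Hd b). intros x [w [Hw ->]].
      specialize (Hmin w Hw). unfold ev. lra. }
    exists q. split; [exact Hq|]. split; [|exact E0]. split.
    - apply (closure_mono U); [apply interior_sub | exact Hq].
    - intros Hi. pose proof (interior_open Om) as Ho. rewrite open_near in Ho.
      destruct (Ho q Hi) as [r [Hr Hball]].
      destruct (support_growth U d q r (r / 2) b Hd Hball) as [G1 G2]; [lra|].
      rewrite E0 in G1, G2. apply Hb.
      assert (Hz : forall z, r / 2 * Rabs (IZR z) <= 0 -> z = 0%Z).
      { intros z Hz. apply eq_IZR. destruct (Req_dec (IZR z) 0) as [|Hn]; [assumption|].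
        apply Rabs_pos_lt in Hn. nra. }
      apply Hz in G1, G2. destruct b; simpl in *; congruence. }
  (* For the constant monomial [d] is 0, and any boundary point of the closure serves; [(1, 0)]
     provides one. *)
  destruct (mono_eq_dec a (0, 0)%Z) as [->|Ha]; [|apply G, Ha].
  destruct (G (1, 0)%Z) as [q [H1 [H2 _]]]; [congruence|]. exists q. split; [exact H1|].
  split; [exact H2|].
  assert (E0 : forall w, ev (0, 0)%Z w = 0) by (intros w; unfold ev; simpl; ring).
  rewrite E0. apply Rle_antisym.
  - assert (d (0, 0)%Z <= 0); [|lra]. apply (Hd (0, 0)%Z). intros x [w [_ ->]]. rewrite E0. lra.
  - pose proof (support_closure U d (0, 0)%Z q Hd H1) as H. rewrite E0 in H. exact H.
Qed.

(* The cone over the face from a boundary zero of its monomial stays in the face. *)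
Lemma minimal_face_touches Om d M c a z :
  is_convex Om -> is_support (r2_interior Om) d -> bounded_by (r2_interior Om) M ->
  (forall b, d b <= c b) -> c a = d a -> face (r2_interior Om) c a z ->
  exists q, r2_closure (face (r2_interior Om) c a) q /\ r2_boundary Om q.
Proof.
  intros HOm Hd HM Hc Ha [Hz Hmin].
  destruct (boundary_zero Om d M a Hd HM) as [q [Hq [Hb E0]]]; [eauto|].
  exists q. split; [|exact Hb]. apply closure_near. intros r Hr.
  destruct (comb_near q z 0 r Hr) as [e [He Hcomb]].
  set (t := Rmin 1 (e / 2)).
  assert (Ht : 0 < t <= 1 /\ t < e).
  { unfold t. pose proof (Rmin_l 1 (e / 2)); pose proof (Rmin_r 1 (e / 2)).
    assert (0 < Rmin 1 (e / 2)) by (apply Rmin_glb_lt; lra). lra. }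
  exists (comb t q z). split.
  - split; [apply interior_segment; [exact HOm | apply Hb | exact Hz | apply Ht]|].
    intros b Hba. rewrite !ev_comb. specialize (Hmin b Hba). specialize (Hc b).
    pose proof (support_closure _ d b q Hd Hq).
    assert (0 <= (1 - t) * (c b + ev b q)) by (apply Rmult_le_pos; lra).
    assert (0 < t * (c b + ev b z - (c a + ev a z))) by (apply Rmult_lt_0_compat; lra).
    assert ((1 - t) * (c a + ev a q) = 0) by (rewrite Ha, E0; ring). lra.
  - replace q with (comb 0 q z) at 1 by (unfold comb; destruct q; simpl; f_equal; ring).
    apply Hcomb. apply Rabs_def1; lra.
Qed.

(** By the growth bound, long monomials exceed [h] at the finitely many points even with the
    coefficient [d b]; lowering one of them to [d b] leaves the minima there intact. *)
Lemma large_monomials_dominate Om d h n pts :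
  is_support (r2_interior Om) d -> (forall i, (i < n)%nat -> r2_interior Om (pts i)) ->
  exists T, forall i b, (i < n)%nat -> T <= Rabs (IZR (fst b)) \/ T <= Rabs (IZR (snd b)) ->
    h (pts i) <= d b + ev b (pts i).
Proof.
  intros Hd Hp.
  (* [finite_radius] yields a small positive number, so the threshold is encoded as its inverse. *)
  destruct (finite_radius (seq 0 n) (fun i r => forall b : mono,
     / r <= Rabs (IZR (fst b)) \/ / r <= Rabs (IZR (snd b)) ->
     h (pts i) <= d b + ev b (pts i))) as [r [Hr H]].
  - intros i Hi. apply in_seq in Hi. pose proof (interior_open Om) as Ho. rewrite open_near in Ho.
    destruct (Ho _ (Hp i ltac:(lia))) as [s [Hs Hball]].
    set (T := (Rabs (h (pts i)) + 1) / (s / 2)).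
    pose proof (Rabs_pos (h (pts i))).
    assert (HT : 0 < T) by (unfold T; apply Rdiv_lt_0_compat; lra).
    assert (HTs : s / 2 * T = Rabs (h (pts i)) + 1) by (unfold T; field; lra).
    exists (/ T). split; [apply Rinv_0_lt_compat, HT|]. intros b Hb. rewrite Rinv_inv in Hb.
    destruct (support_growth _ d _ s (s / 2) b Hd Hball) as [G1 G2]; [lra|].
    pose proof (Rle_abs (h (pts i))).
    destruct Hb as [Hb|Hb]; apply (Rmult_le_compat_l (s / 2)) in Hb; lra.
  - intros i r r' Hr H b Hb. apply H.
    assert (/ r <= / r') by (apply Rinv_le_contravar; lra). destruct Hb; [left | right]; lra.
  - exists (/ r). intros i b Hi Hb. apply (H i); [apply in_seq; lia | exact Hb].
Qed.

(* Near a boundary point [q] the series is cut by [d b + ev b] for a large lattice direction [b]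
   close to the inner normal of a supporting line at [q]. *)
Lemma nonminimal_face_inner Om d M n pts c h a q :
  is_convex Om -> is_support (r2_interior Om) d -> bounded_by (r2_interior Om) M ->
  (forall b, d b <= c b) ->
  (forall i, (i < n)%nat -> r2_interior Om (pts i) /\ two_min c (pts i)) ->
  represents (r2_interior Om) c h -> least_admissible Om n pts h ->
  d a < c a -> r2_closure (face (r2_interior Om) c a) q -> ~ r2_boundary Om q.
Proof.
  intros HOm Hd HM Hc Hp Hr Hmin Ha Hq [_ Hqi]. set (U := r2_interior Om) in *.
  assert (HqU : r2_closure U q) by (apply (closure_mono (face U c a)); [intros z []; auto | exact Hq]).
  assert (exists z, U z) as [z0 Hz0].
  { rewrite closure_near in HqU. destruct (HqU 1 Rlt_0_1) as [z [Hz _]]; eauto. }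
  destruct (supporting_line U q z0 (interior_convex Om HOm) (interior_open Om) Hz0 Hqi)
    as [u1 [u2 [Hu Hline]]].
  assert (Hqb : Rabs (fst q) <= M /\ Rabs (snd q) <= M).
  { assert (G : forall x y, (forall w, U w -> Rabs (x * fst w + y * snd w) <= M) ->
                  Rabs (x * fst q + y * snd q) <= M).
    { intros x y H.
      pose proof (affine_closure U M x y q) as A1. pose proof (affine_closure U M (- x) (- y) q) as A2.
      apply Rabs_le. split.
      - assert (0 <= M + x * fst q + y * snd q); [|lra]. apply A1; [|exact HqU].
        intros w Hw. specialize (H w Hw). apply Rabs_le_inv in H. lra.
      - assert (0 <= M + - x * fst q + - y * snd q); [|lra]. apply A2; [|exact HqU].
        intros w Hw. specialize (H w Hw). apply Rabs_le_inv in H. lra. }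
    split.
    - replace (fst q) with (1 * fst q + 0 * snd q) by ring. apply G. intros w Hw.
      replace (1 * fst w + 0 * snd w) with (fst w) by ring. apply HM, Hw.
    - replace (snd q) with (0 * fst q + 1 * snd q) by ring. apply G. intros w Hw.
      replace (0 * fst w + 1 * snd w) with (snd w) by ring. apply HM, Hw. }
  assert (HM0 : 0 <= M) by (pose proof (Rabs_pos (fst q)); lra).
  destruct (large_monomials_dominate Om d h n pts Hd) as [T HT]; [intros i Hi; apply Hp, Hi|].
  (* Replacing [b] by [t * u] costs at most [2 * M * delta] in each coordinate; the constant 8 keeps
     the total below [eta / 2]. *)
  set (eta := c a - d a). set (delta := eta / (8 * (M + 1))).
  assert (Heta : 0 < eta) by (unfold eta; lra).
  assert (Hdelta : 0 < delta) by (unfold delta; apply Rdiv_lt_0_compat; lra).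
  assert (Hde : delta * (8 * (M + 1)) = eta) by (unfold delta; field; lra).
  destruct (lattice_direction u1 u2 delta T Hu Hdelta) as [b [t [Ht [B1 [B2 HbT]]]]].
  assert (Hbq : d b + ev b q <= eta / 2).
  { assert (d b <= eta / 2 - ev b q); [|lra]. apply (Hd b). intros x [w [Hw ->]].
    specialize (Hline w Hw). destruct (HM w Hw) as [W1 W2]. destruct Hqb as [Q1 Q2].
    assert (G : forall x y k, Rabs x <= M -> Rabs y <= M -> Rabs k <= delta ->
                - (2 * M * delta) <= k * (x - y)).
    { intros x y k Hx Hy Hk.
      assert (Rabs (k * (x - y)) <= delta * (2 * M)).
      { rewrite Rabs_mult. apply Rmult_le_compat; try apply Rabs_pos; [exact Hk|].
        apply Rabs_le_inv in Hx, Hy. apply Rabs_le. lra. }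
      apply Rabs_le_inv in H. lra. }
    pose proof (G _ _ _ W1 Q1 B1) as G1. pose proof (G _ _ _ W2 Q2 B2) as G2.
    assert (0 <= t * (u1 * (fst w - fst q) + u2 * (snd w - snd q))) by (apply Rmult_le_pos; lra).
    unfold ev. nra. }
  (* Lowering [b] to [d b] gives an admissible series [g], so [h <= g <= d b + ev b] on the
     interior. *)
  set (c' := fun e => if mono_eq_dec e b then d b else c e).
  assert (Hb' : c' b = d b) by (unfold c'; destruct (mono_eq_dec b b); congruence).
  assert (He' : forall e, e <> b -> c' e = c e).
  { intros e He; unfold c'; destruct (mono_eq_dec e b); [contradiction | reflexivity]. }
  destruct (admissible_of_two_min Om d n pts c' Hd) as [g [Hg Hrg]].
  { intros e. destruct (mono_eq_dec e b) as [->|E]; [rewrite Hb'; lra | rewrite (He' e E); apply Hc]. }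
  { intros i Hi. destruct (Hp i Hi) as [HU [a1 [a2 [H12 [E Hm]]]]]. split; [exact HU|].
    specialize (HT i b Hi HbT).
    assert (E1 : h (pts i) = c a1 + ev a1 (pts i)) by (apply (min_value U c h _ _ Hr HU), Hm).
    assert (Hkeep : forall x, h (pts i) = c x + ev x (pts i) -> c' x = c x).
    { intros x Hx. destruct (mono_eq_dec x b) as [->|Hxb]; [|apply He', Hxb].
      rewrite Hb'. specialize (Hc b). lra. }
    exists a1, a2. split; [exact H12|]. rewrite !Hkeep by congruence. split; [exact E|].
    intros e. rewrite <- E1. destruct (mono_eq_dec e b) as [->|Heb].
    - rewrite Hb'. exact HT.
    - rewrite (He' e Heb). apply Hr, HU. }
  assert (Hcut : forall z, face U c a z -> 0 <= (d b - c a) + (IZR (fst b) - IZR (fst a)) * fst z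
                                                + (IZR (snd b) - IZR (snd a)) * snd z).
  { intros z [Hz Hza]. specialize (Hmin g Hg z Hz). destruct (Hrg z Hz) as [_ Hle].
    specialize (Hle b). rewrite Hb' in Hle.
    assert (h z = c a + ev a z).
    { apply (min_value U c h z a Hr Hz). intros e.
      destruct (mono_eq_dec e a) as [->|Hea]; [lra | left; apply Hza, Hea]. }
    unfold ev in *. lra. }
  (* At [q] the cut gives [c a + ev a q <= eta / 2], whereas [d a + ev a q >= 0] gives at least
     [eta]. *)
  pose proof (affine_closure _ _ _ _ q Hcut Hq) as Hfin.
  pose proof (support_closure U d a q Hd HqU) as Haq. unfold eta, ev in *. lra.
Qed.

(** * Faces as connected components *)

(** Faces are open, pairwise disjoint and cover the complement of the curve; the face of [a] and the
    union of all others would separate [T]. *)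
Lemma connected_in_face Om d c h T a z :
  is_support (r2_interior Om) d -> (forall b, d b <= c b) -> represents (r2_interior Om) c h ->
  connected T -> (forall p, T p -> r2_interior Om p /\ ~ trop_curve Om h p) ->
  T z -> face (r2_interior Om) c a z -> forall p, T p -> face (r2_interior Om) c a p.
Proof.
  intros Hd Hc Hr Hconn HT Hz Ha p Hp. set (U := r2_interior Om) in *.
  assert (Ho : is_open U) by apply interior_open.
  assert (Hface : forall p, T p -> exists b, face U c b p).
  { intros w Hw. destruct (HT w Hw) as [HU Hn].
    destruct (two_min_or_face U c h w Hr HU) as [H2|]; [|assumption].
    destruct Hn. split; [exact HU|].
    apply (curve_two_min U d c h); auto. }
  assert (Hop : forall b, is_open (face U c b)).
  { intros b. apply (face_open U d); auto. }
  apply NNPP; intros Hno. apply Hconn.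
  exists (face U c a), (fun w => exists b, b <> a /\ face U c b w). split; [apply Hop|]. split.
  { intros w [b [Hb Hw]]. destruct (Hop b w Hw) as [r [Hr0 Hball]].
    exists r. split; [exact Hr0|]. intros v Hv. exists b; auto. }
  split; [|split; [exists z; auto | split]].
  - intros w Hw. destruct (Hface w Hw) as [b Hb]. destruct (mono_eq_dec b a) as [->|]; [auto|].
    right; exists b; auto.
  - exists p. split; [exact Hp|]. destruct (Hface p Hp) as [b Hb]. exists b. split; [|exact Hb].
    intros ->. contradiction.
  - intros w _ [_ H1] [b [Hb [_ H2]]]. specialize (H1 b Hb). specialize (H2 a (not_eq_sym Hb)). lra.
Qed.

Lemma face_component Om d c h a z :
  is_convex Om ->
  is_support (r2_interior Om) d -> (forall b, d b <= c b) -> represents (r2_interior Om) c h ->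
  face (r2_interior Om) c a z ->
  is_component (fun p => r2_interior Om p /\ ~ trop_curve Om h p) (face (r2_interior Om) c a).
Proof.
  intros HOm Hd Hc Hr Ha. split; [exists z; exact Ha|]. split; [|split].
  - intros p Hp. split; [apply Hp|]. intros [_ Hn]. apply Hn.
    apply (face_differentiable (r2_interior Om) d c h a); auto using interior_open.
  - apply convex_connected, face_convex, interior_convex, HOm.
  - intros T HT Hsub HTA. apply (connected_in_face Om d c h T a z); auto.
Qed.

Lemma component_face Om d c h S :
  is_convex Om ->
  is_support (r2_interior Om) d -> (forall b, d b <= c b) -> represents (r2_interior Om) c h ->
  is_component (fun p => r2_interior Om p /\ ~ trop_curve Om h p) S ->
  exists a z, face (r2_interior Om) c a z /\ same_set S (face (r2_interior Om) c a).
Proof.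
  intros HOm Hd Hc Hr [[z Hz] [HSA [Hconn Hmax]]].
  destruct (HSA z Hz) as [HU Hn].
  assert (exists a, face (r2_interior Om) c a z) as [a Ha].
  { destruct (two_min_or_face _ c h z Hr HU) as [H2|]; [|assumption].
    destruct Hn. split; [exact HU|].
    apply (curve_two_min (r2_interior Om) d c h); auto using interior_open. }
  exists a, z. split; [exact Ha|].
  assert (Hin : forall p, S p -> face (r2_interior Om) c a p).
  { apply (connected_in_face Om d c h S a z); auto. }
  destruct (face_component Om d c h a z HOm Hd Hc Hr Ha) as [_ [H1 [H2 _]]].
  intros p; split; [apply Hin|]. apply (Hmax _ H2 Hin H1).
Qed.

Lemma genus_of_least Om d M n pts c h :
  is_convex Om -> is_support (r2_interior Om) d -> bounded_by (r2_interior Om) M ->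
  (forall b, d b <= c b) ->
  (forall i, (i < n)%nat -> r2_interior Om (pts i) /\ two_min c (pts i)) ->
  represents (r2_interior Om) c h -> least_admissible Om n pts h ->
  ~ special d n pts -> genus_eq Om h n.
Proof.
  intros HOm Hd HM Hc Hp Hr Hmin Hns. set (U := r2_interior Om) in *.
  destruct (finite_of_bounded (fun x => d x < c x /\ attained U c h x) n) as [K [HK1 [HK2 HK3]]].
  { intros l Hl HP. apply (attained_bound Om d n pts c h l); auto. }
  assert (HK4 : (n <= length K)%nat).
  { apply (nonspecial_lower_bound d n pts c); [exact Hns | intros i Hi; apply Hp, Hi |].
    intros i a Hi Hma Hne. destruct (Hp i Hi) as [HU _].
    apply HK2. specialize (Hc a). split; [lra|]. exists (pts i). split; [exact HU|].
    apply (min_value U c h _ _ Hr HU), Hma. }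
  assert (Hnonempty : forall a, In a K -> exists z, face U c a z).
  { intros a Ha. apply HK2 in Ha as [Ha1 Ha2]. apply (attained_face Om d n pts c h); auto. }
  assert (Hnth : forall i, (i < n)%nat -> In (nth i K (0, 0)%Z) K).
  { intros i Hi. apply nth_In. unfold mono in *; lia. }
  exists (fun i => face U c (nth i K (0, 0)%Z)). split; [|split].
  - intros i Hi. set (a := nth i K (0, 0)%Z). assert (Ha : In a K) by apply Hnth, Hi.
    destruct (Hnonempty a Ha) as [z Hz]. split.
    + apply (face_component Om d c h a z); auto.
    + intros [q [Hq Hb]]. revert Hb.
      apply (nonminimal_face_inner Om d M n pts c h a); auto. apply HK2, Ha.
  - intros i j Hi Hj Hsame. destruct (Hnonempty _ (Hnth i Hi)) as [z Hz].
    assert (Hz' := proj1 (Hsame z) Hz). destruct Hz as [_ Hz], Hz' as [_ Hz'].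
    apply (proj1 (NoDup_nth K (0, 0)%Z) HK1); [unfold mono in *; lia | unfold mono in *; lia |].
    apply NNPP; intros Hne. specialize (Hz _ (not_eq_sym Hne)). specialize (Hz' _ Hne). lra.
  - intros S [HS Hnb]. destruct (component_face Om d c h S HOm Hd Hc Hr HS) as [a [z [Hz Hsame]]].
    assert (Hda : d a < c a).
    { destruct (Hc a) as [|E]; [assumption|]. destruct Hnb.
      destruct (minimal_face_touches Om d M c a z HOm Hd HM Hc (eq_sym E) Hz) as [q [Hq Hb]].
      exists q. split; [|exact Hb]. apply (closure_mono (face U c a)); [|exact Hq].
      intros p Hpf. apply Hsame, Hpf. }
    assert (HaK : In a K).
    { apply HK2. split; [exact Hda|]. exists z. split; [apply Hz|].
      apply (min_value U c h z a Hr (proj1 Hz)). intros e.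
      destruct (mono_eq_dec e a) as [->|Hea]; [lra | left; apply Hz, Hea]. }
    destruct (In_nth K a (0, 0)%Z HaK) as [i [Hi E]]. exists i.
    split; [unfold mono in *; lia|]. rewrite E. exact Hsame.
Qed.

Theorem mainTheorem1 (Om : region) (n : nat) :
  is_compact Om -> is_convex Om -> (exists p, r2_interior Om p) -> (1 <= n)%nat ->
  exists N : (nat -> pt) -> Prop, null_set n N /\
    forall pts : nat -> pt,
      (forall i, (i < n)%nat -> r2_interior Om (pts i)) -> ~ N pts ->
      (exists f, is_GP Om n pts zero_fun f) /\
      (forall f, is_GP Om n pts zero_fun f -> genus_eq Om f n).
Proof.
  (* The maximum with 1 makes the half-side of the cube positive. *)
  intros [_ [M0 HM0]] HOm Hne Hn. set (M := Rmax M0 1).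
  assert (HM : bounded_by (r2_interior Om) M).
  { intros w Hw. destruct (HM0 w (interior_sub Om w Hw)) as [H1 H2].
    pose proof (Rmax_l M0 1). unfold M. lra. }
  assert (HMpos : 0 < M) by (unfold M; pose proof (Rmax_r M0 1); lra).
  destruct (support_exists (r2_interior Om) M HM Hne) as [d Hd].
  (* The cube contains every tuple of interior points, so outside this set such a tuple is not
     special. *)
  exists (fun pts => in_cube n M pts /\ special d n pts).
  split; [apply special_null; assumption|]. intros pts Hp HN.
  assert (Hns : ~ special d n pts).
  { intros Hs. apply HN. split; [|exact Hs]. intros i Hi. apply HM, Hp, Hi. }
  destruct (GP_exists Om d M n pts Hd HM Hne Hp) as [c [f [Hf [Hc [H2 Hall]]]]].
  split; [exists f; exact Hf|]. intros h Hh. destruct (Hall h Hh) as [Hr Hmin].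
  apply (genus_of_least Om d M n pts c h); auto.
Qed.
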